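(* Let $\mathbf{D}$ be a semisimple Abelian category with only one simple object up to isomorphism, equipped with the rank function $\mathrm{length}$. Then the interleaving and bottleneck distances coincide on tame $(\mathbb{R},\le)$-indexed diagrams, i.e. for all tame functors $F,G:(\mathbb{R},\le)\to\mathbf{D}$, $$d_{\mathbf{D}}(F,G)=d(\mathcal{D}F,\mathcal{D}G).$$ (That is, $(\mathbf{D},\mathrm{length})$ is tight.)
   Context: An Abelian category is semisimple if each object is a finite direct sum of simple objects. The length of an object $X$ is $n$ if there is a chain $0\simeq X_0\hookrightarrow X_1\hookrightarrow\dots\hookrightarrow X_n\simeq X$ with all quotients $X_i/X_{i-1}$ simple. An $(\mathbb{R},\le)$-indexed diagram in $\mathbf{D}$ is a functor $F:(\mathbb{R},\le)\to\mathbf{D}$. Put $p_F(u,v)=\mathrm{length}(\mathrm{im}(F(u\le v)))$ for real $u\le v$. Tameness: $F$ is constant on an interval $I\subset\mathbb{R}$ if $p_F(a,a)=p_F(a,b)=p_F(b,b)$ for all $a\le b$ in $I$. A point $a\in\mathbb{R}$ is a regular value if $F$ is constant on some connected neighborhood of $a$, and a critical value otherwise. $F$ is tame if it has finitely many critical values. Multiplicity: for $u<v$ in $\mathbb{R}\cup\{-\infty,+\infty\}$, the multiplicity $\mu(u,v)$ is the minimum, over disjoint connected neighborhoods $I_u,I_v$ of $u$ and $v$, of $$p_F(\sup I_u,\inf I_v)-p_F(\inf I_u,\inf I_v)-p_F(\sup I_u,\sup I_v)+p_F(\inf I_u,\sup I_v),$$ with the convention that $p_F(u,v)=\min_{x,y}p_F(x,y)$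 (the minimum of $p_F$ over real $x\le y$) whenever $u$ or $v$ is not finite. If $\mu(u,v)>0$, $(u,v)$ is a cornerpoint. The persistence diagram $\mathcal{D}F$ is the multiset of the cornerpoints (with multiplicity $\mu$), along with all diagonal points $(u,u)$, $u\in\mathbb{R}$, each with countably infinite multiplicity. Bottleneck distance: $d(\mathcal{D}F,\mathcal{D}G)=\inf_{\beta}\sup_{q\in\mathcal{D}F}\|q-\beta(q)\|_\infty$, where $\beta$ ranges over all bijections of multisets $\mathcal{D}F\to\mathcal{D}G$ (equal infinite coordinates are at distance $0$, a finite and an infinite coordinate, or two different infinite ones, at distance $\infty$). Interleaving distance: let $T_b:(\mathbb{R},\le)\to(\mathbb{R},\le)$, $T_b(a)=a+b$, and for $b\ge 0$ let $\eta_b:\mathrm{Id}\to T_b$ be the natural transformation $a\le a+b$. For $\epsilon\ge0$, $F,G:(\mathbb{R},\le)\to\mathbf{D}$ are $\epsilon$-interleaved if there are natural transformations $\phi^F:F\to GT_\epsilon$, $\phi^G:G\to FT_\epsilon$ with $(\phi^GT_\epsilon)\phi^F=F\eta_{2\epsilon}$ and $(\phi^FT_\epsilon)\phi^G=G\eta_{2\epsilon}$. The interleaving distance $d_{\mathbf{D}}(F,G)$ is the infimum of all $\epsilon$ such that $F,G$ are $\epsilon$-interleaved ($\infty$ if there are none).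
   Formalization: p_F(u,v) is taken to be 0, not min p_F, when u or v is infinite; only μ(−∞,+∞) changes, from 0 to min p_F. With the stated convention the claim fails: F constant on a simple object and G=0 have equal diagrams but infinite interleaving distance. *)

(* Defs.v *)
From HB Require Import structures.
From mathcomp Require Import all_boot all_order all_algebra.
From mathcomp Require Import all_classical all_reals all_analysis.
Set Implicit Arguments.
Unset Strict Implicit.
Unset Printing Implicit Defensive.
Import Order.TTheory GRing.Theory Num.Theory.
Import numFieldNormedType.Exports.
Local Open Scope classical_set_scope.
Local Open Scope ring_scope.

(* A zmodType carries decidable equality and a choice operator on top of its
   group structure; classically this is no restriction on the hom-groups. *)
Record preadditive := Preadditive {
  obj :> Type;
  mor : obj -> obj -> zmodType;
  idm : forall X, mor X X;
  compose : forall X Y Z, mor Y Z -> mor X Y -> mor X Z;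
  comp1m : forall X Y (f : mor X Y), compose (idm Y) f = f;
  compm1 : forall X Y (f : mor X Y), compose f (idm X) = f;
  compA : forall X Y Z W (h : mor Z W) (g : mor Y Z) (f : mor X Y),
    compose h (compose g f) = compose (compose h g) f;
  compDl : forall X Y Z (g g' : mor Y Z) (f : mor X Y),
    compose (g + g') f = compose g f + compose g' f;
  compDr : forall X Y Z (g : mor Y Z) (f f' : mor X Y),
    compose g (f + f') = compose g f + compose g f'
}.

Notation "g \oc f" := (compose g f) (at level 50, left associativity).

Section Preadditive.
Variable C : preadditive.
Implicit Types X Y Z : C.

Definition mono X Y (f : mor X Y) : Prop :=
  forall Z (g h : mor Z X), f \oc g = f \oc h -> g = h.

Definition epi X Y (f : mor X Y) : Prop :=
  forall Z (g h : mor Y Z), g \oc f = h \oc f -> g = h.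

Definition is_iso X Y (f : mor X Y) : Prop :=
  exists g : mor Y X, g \oc f = idm X /\ f \oc g = idm Y.

Definition isomorphic X Y : Prop := exists f : mor X Y, is_iso f.

(* Maps into and out of X always exist, namely 0. *)
Definition is_zero X : Prop :=
  forall Y, (forall f g : mor X Y, f = g) /\ (forall f g : mor Y X, f = g).

Definition is_kernel X Y (f : mor X Y) K (k : mor K X) : Prop :=
  f \oc k = 0 /\
  forall Z (g : mor Z X), f \oc g = 0 -> exists! h : mor Z K, k \oc h = g.

Definition is_cokernel X Y (f : mor X Y) Q (q : mor Y Q) : Prop :=
  q \oc f = 0 /\
  forall Z (g : mor Y Z), g \oc f = 0 -> exists! h : mor Q Z, h \oc q = g.

(* For n = 0 this says that X is a zero object. *)
Definition is_direct_sum n (S : 'I_n -> C) X : Prop :=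
  exists (i : forall j, mor (S j) X) (p : forall j, mor X (S j)),
    [/\ forall j, p j \oc i j = idm (S j),
        forall j k, j != k -> p j \oc i k = 0
      & \sum_(j < n) (i j \oc p j) = idm X].

Definition simple_object X : Prop :=
  ~ is_zero X /\ forall Y (i : mor Y X), mono i -> is_zero Y \/ is_iso i.

(* The objects Z i and the maps m i with i > n resp. i >= n are irrelevant. *)
Definition has_length X (n : nat) : Prop :=
  exists (Z : nat -> C) (m : forall i, mor (Z i) (Z i.+1)),
    [/\ is_zero (Z 0%N), isomorphic (Z n) X
      & forall i, (i < n)%N ->
          mono (m i) /\
          exists Q (q : mor (Z i.+1) Q), is_cokernel (m i) q /\ simple_object Q].

(* Unique by the Jordan-Hoelder theorem if C is abelian; the value is 0 on
   objects of infinite length. *)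
Definition length X : nat := xget 0%N [set n | has_length X n].

End Preadditive.

Record abelian_category := AbelianCategory {
  acat :> preadditive;
  has_direct_sums : forall n (S : 'I_n -> acat), exists X, is_direct_sum S X;
  has_kernels : forall (X Y : acat) (f : mor X Y),
    exists K (k : mor K X), is_kernel f k;
  has_cokernels : forall (X Y : acat) (f : mor X Y),
    exists Q (q : mor Y Q), is_cokernel f q;
  mono_normal : forall (X Y : acat) (f : mor X Y), mono f ->
    exists Z (g : mor Y Z), is_kernel g f;
  epi_normal : forall (X Y : acat) (f : mor X Y), epi f ->
    exists Z (g : mor Z X), is_cokernel g f
}.

Definition is_image (C : preadditive) (X Y : C) (f : mor X Y) (I : C) : Prop :=
  exists (m : mor I Y) (Q : C) (q : mor Y Q), is_cokernel f q /\ is_kernel q m.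

Lemma image_exists (D : abelian_category) (X Y : D) (f : mor X Y) :
  exists I, is_image f I.
Proof.
have [Q [q cq]] := has_cokernels f.
have [I [m km]] := has_kernels q.
by exists I, m, Q, q.
Qed.

Definition im (D : abelian_category) (X Y : D) (f : mor X Y) : D :=
  projT1 (cid (image_exists f)).

Definition semisimple (D : abelian_category) : Prop :=
  forall X : D, exists n (S : 'I_n -> D),
    (forall j, simple_object (S j)) /\ is_direct_sum S X.

Definition unique_simple (D : abelian_category) : Prop :=
  exists2 S : D, simple_object S
    & forall S' : D, simple_object S' -> isomorphic S S'.

Record diagram (R : realType) (D : preadditive) := Diagram {
  dob :> R -> D;
  dmor : forall u v : R, u <= v -> mor (dob u) (dob v);
  dmor_id : forall (u : R) (h : u <= u), dmor h = idm (dob u);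
  dmor_comp : forall (u v w : R) (h1 : u <= v) (h2 : v <= w) (h : u <= w),
    dmor h = dmor h2 \oc dmor h1
}.

Record nat_trans (R : realType) (D : preadditive) (F G : diagram R D) :=
  NatTrans {
  component :> forall a : R, mor (F a) (G a);
  naturality : forall (a b : R) (h : a <= b),
    component b \oc dmor F h = dmor G h \oc component a
}.

Section Interleaving.
Variables (R : realType) (D : preadditive).
Implicit Types F G : diagram R D.

Lemma translate_le (e a b : R) : a <= b -> a + e <= b + e.
Proof. by rewrite lerD2r. Qed.

(* F T_e *)
Definition shift (e : R) F : diagram R D :=
  @Diagram R D (fun a => F (a + e))
    (fun a b h => dmor F (translate_le e h))
    (fun a h => dmor_id F (translate_le e h))
    (fun a b c h1 h2 h => dmor_comp F (translate_le e h1) (translate_le e h2)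
                                      (translate_le e h)).

(* T_(2e) a is written a + e + e, so that the composites typecheck; h ranges
   over the proofs of an inequality that holds because 0 <= e. *)
Definition interleaved (e : R) F G : Prop :=
  0 <= e /\
  exists (phi : nat_trans F (shift e G)) (psi : nat_trans G (shift e F)),
    (forall a (h : a <= a + e + e), psi (a + e) \oc phi a = dmor F h) /\
    (forall a (h : a <= a + e + e), phi (a + e) \oc psi a = dmor G h).

Definition interleaving_distance F G : \bar R :=
  ereal_inf [set e%:E | e in [set e : R | interleaved e F G]].

End Interleaving.

Section Persistence.
Variables (R : realType) (D : abelian_category).
Implicit Types F G : diagram R D.

(* p_F(u, v); only meaningful for u <= v. *)
Definition pers F (u v : R) : nat :=
  match @idP (u <= v) with
  | ReflectT h => length (im (dmor F h))
  | ReflectF _ => 0%N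
  end.

Definition constant_on F (I : set R) : Prop :=
  forall a b, I a -> I b -> a <= b ->
    pers F a a = pers F a b /\ pers F a b = pers F b b.

Definition regular_value F (a : R) : Prop :=
  exists I : set R, [/\ nbhs a I, connected I & constant_on F I].

Definition tame F : Prop := finite_set [set a : R | ~ regular_value F a].

(* F is extended by the zero object to -oo and +oo, so p_F is 0 there.  With
   the value min_(x <= y) p_F(x, y) instead, the only multiplicity that changes
   is that of (-oo, +oo), which becomes 0: direct summands supported on the
   whole line would be missing from the persistence diagram, and the constant
   diagram on a simple object would have the diagram of the zero functor. *)
Definition epers F (u v : \bar R) : int :=
  match u, v with
  | x%:E, y%:E => (pers F x y)%:Z
  | _, _ => 0
  end.

Definition box_count F (Iu Iv : set (\bar R)) : int :=
  epers F (ereal_sup Iu) (ereal_inf Iv)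
  - epers F (ereal_inf Iu) (ereal_inf Iv)
  - epers F (ereal_sup Iu) (ereal_sup Iv)
  + epers F (ereal_inf Iu) (ereal_sup Iv).

Definition box_counts F (u v : \bar R) : set int :=
  [set z | exists Iu Iv : set (\bar R),
     [/\ nbhs u Iu /\ connected Iu, nbhs v Iv /\ connected Iv,
         Iu `&` Iv = set0 & z = box_count F Iu Iv]].

Definition multiplicity F (u v : \bar R) : int :=
  xget 0 [set z | box_counts F u v z /\
                  forall z', box_counts F u v z' -> z <= z'].

(* A multiset is encoded by its set of numbered copies: (q, k) is the k-th
   copy of q, counting from 0. *)
Definition persistence_diagram F : set ((\bar R * \bar R) * nat) :=
  [set qk | let: ((u, v), k) := qk in
     ((u < v)%E /\ k%:Z < multiplicity F u v) \/
     exists x : R, u = x%:E /\ v = x%:E].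

(* Not `|x - y|%E, which is +oo when x = y is infinite. *)
Definition coord_dist (x y : \bar R) : \bar R :=
  match x, y with
  | a%:E, b%:E => `|a - b|%:E
  | +oo%E, +oo%E | -oo%E, -oo%E => 0%E
  | _, _ => +oo%E
  end.

Definition point_dist (p q : \bar R * \bar R) : \bar R :=
  Order.max (coord_dist p.1 q.1) (coord_dist p.2 q.2).

Definition bottleneck_distance F G : \bar R :=
  ereal_inf
    [set ereal_sup [set point_dist q.1 (beta q).1
                   | q in persistence_diagram F]
    | beta in [set beta : (\bar R * \bar R) * nat -> (\bar R * \bar R) * nat
              | set_bij (persistence_diagram F) (persistence_diagram G) beta]].

End Persistence.

(* Main.v *)
Require Import Defs.
From HB Require Import structures.
From mathcomp Require Import all_boot all_order all_algebra.
From mathcomp Require Import all_classical all_reals all_analysis.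
From mathcomp Require Import lra.
Set Implicit Arguments.
Unset Strict Implicit.
Unset Printing Implicit Defensive.
Import Order.TTheory GRing.Theory Num.Theory.
Import numFieldNormedType.Exports.
Local Open Scope classical_set_scope.
Local Open Scope ring_scope.

(* For the simple object S, Hom(S, -) identifies D with the finite-dimensional
   vector spaces over the division ring End(S), and length with dimension.  A
   tame diagram is, up to isomorphism, a finite sequence of vector spaces; going
   through it from left to right and always eliminating the youngest vector of a
   linear relation decomposes the diagram into interval modules (bars), and
   mu(u, v) counts the bars with endpoints u < v.

   If F and G are eps-interleaved, the components of the interleaving maps
   between bars form matrices over End(S).  Restricted to a set A of bars of
   length > 2 eps, ordered by birth + death, and to the bars of G that are
   eps-close to a member of A, their product is unitriangular; hence A has at
   least #|A| close bars in G (Bjerkevik's argument).  Hall's marriage theorem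
   then matches the long bars of F injectively, likewise those of G, and the
   Cantor-Bernstein construction merges both matchings into one bijection of
   persistence diagrams.  Conversely, a bijection moving points by at most eps
   gives an eps'-interleaving for all eps' > eps: it sends each bar to its
   partner and the bars matched to the diagonal to 0. *)

(** Vectors of X are morphisms from S to X, with End(S) acting on the right. A bar is one index at
    all times, its vector being 0 outside the lifetime. The youngest vector is eliminated because
    the combination replacing it must be available whenever that vector is alive.

    The order by birth + death serves to discard bars: the full product of the two matrices is an
    internal map of F, but only the bars of G close to A may be kept. A nonzero path from bar i to
    bar i' through bar j, with birth + death not decreasing, makes j close to i or i', so on one
    side of the diagonal nothing is lost. As birth + death means nothing for the whole line,
    infinite endpoints are modelled by large reals.

    Multiplicities see infima and suprema of bars, not whether endpoints are attained. Hence the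
    converse needs [eps' > eps], which is harmless as the distances are infima. *)

(** * Linear algebra over the simple object *)

(* \oc has the same level as addition, which makes it awkward in sums. *)
Local Notation "g \cm f" := (compose g f) (at level 40, left associativity).

(* The name compA is shadowed by the lemma on composition of functions. *)
Definition compmA := @Defs.compA.

Section PreadditiveTheory.
Variable C : preadditive.
Implicit Types X Y Z : C.

Lemma comp0m X Y Z (f : mor X Y) : (0 : mor Y Z) \cm f = 0.
Proof. by apply: (addIr (0 \cm f)); rewrite -compDl !add0r. Qed.

Lemma compm0 X Y Z (f : mor Y Z) : f \cm (0 : mor X Y) = 0.
Proof. by apply: (addIr (f \cm 0)); rewrite -compDr !add0r. Qed.

Lemma compNm X Y Z (g : mor Y Z) (f : mor X Y) : (- g) \cm f = - (g \cm f).
Proof. by apply: (addIr (g \cm f)); rewrite -compDl !addNr comp0m. Qed.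

Lemma compmN X Y Z (g : mor Y Z) (f : mor X Y) : g \cm (- f) = - (g \cm f).
Proof. by apply: (addIr (g \cm f)); rewrite -compDr !addNr compm0. Qed.

Lemma compBl X Y Z (g g' : mor Y Z) (f : mor X Y) :
  (g - g') \cm f = g \cm f - g' \cm f.
Proof. by rewrite compDl compNm. Qed.

Lemma compBr X Y Z (g : mor Y Z) (f f' : mor X Y) :
  g \cm (f - f') = g \cm f - g \cm f'.
Proof. by rewrite compDr compmN. Qed.

Lemma comp_suml X Y Z (I : finType) (P : pred I) (g : I -> mor Y Z)
    (f : mor X Y) :
  (\sum_(i | P i) g i) \cm f = \sum_(i | P i) g i \cm f.
Proof.
apply: (big_morph (fun g => g \cm f)) => [g1 g2|]; first exact: compDl.
exact: comp0m.
Qed.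

Lemma comp_sumr X Y Z (I : finType) (P : pred I) (g : mor Y Z)
    (f : I -> mor X Y) :
  g \cm (\sum_(i | P i) f i) = \sum_(i | P i) g \cm f i.
Proof.
apply: (big_morph (fun f => g \cm f)) => [f1 f2|]; first exact: compDr.
exact: compm0.
Qed.

Lemma mono0 X Y (f : mor X Y) :
  (forall Z (g : mor Z X), f \cm g = 0 -> g = 0) -> mono f.
Proof.
move=> f0 Z g h fgh; apply/eqP; rewrite -subr_eq0; apply/eqP/f0.
by rewrite compBr fgh subrr.
Qed.

Lemma mono_eq0 X Y (f : mor X Y) : mono f ->
  forall Z (g : mor Z X), f \cm g = 0 -> g = 0.
Proof. by move=> mf Z g fg0; apply: mf; rewrite compm0. Qed.

Lemma is_zeroP X : is_zero X <-> idm X = 0.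
Proof.
split=> [X0|X0 Y]; first exact: (X0 X).1.
split=> f g; first by rewrite -(compm1 f) -(compm1 g) X0 !compm0.
by rewrite -(comp1m f) -(comp1m g) X0 !comp0m.
Qed.

Lemma kernel_mono X Y (f : mor X Y) K (k : mor K X) : is_kernel f k -> mono k.
Proof.
move=> [fk kP] Z g h kgh.
have [|u [_ uU]] := kP Z (k \cm g); first by rewrite compmA fk comp0m.
by rewrite -(uU g) // -(uU h).
Qed.

Lemma cokernel_epi X Y (f : mor X Y) Q (q : mor Y Q) : is_cokernel f q -> epi q.
Proof.
move=> [qf qP] Z g h gqh.
have [|u [_ uU]] := qP Z (g \cm q); first by rewrite -compmA qf compm0.
by rewrite -(uU g) // -(uU h).
Qed.

End PreadditiveTheory.

Section Families.
Variables (C : preadditive) (S : C).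
Implicit Types (X : C) (I J : finType).

(** The terms, not the coefficients, have to vanish, so that zero vectors do no harm. *)
Definition indep X I (e : I -> mor S X) : Prop :=
  forall c : I -> mor S S,
    \sum_i e i \cm c i = 0 -> forall i, e i \cm c i = 0.

Definition spans X I (e : I -> mor S X) : Prop :=
  forall v : mor S X, exists c : I -> mor S S, v = \sum_i e i \cm c i.

(* Zero vectors are allowed in a basis: the vectors of a persistence module
   that are not alive at a given time are represented by 0. *)
Definition is_basis X I (e : I -> mor S X) : Prop := indep e /\ spans e.

Definition nonzeros X I (e : I -> mor S X) : {set I} :=
  finset (fun i => e i != 0).

(** Coordinate functionals. The coordinate at a zero vector is arbitrary and fixed to be 0. *)
Definition is_dual X I (e : I -> mor S X) (p : I -> mor X S) : Prop :=
  [/\ forall i j, p i \cm e j = if (i == j) && (e i != 0) then idm S else 0,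
      forall i, e i = 0 -> p i = 0
    & \sum_i e i \cm p i = idm X].

(* S behaves as a one-dimensional vector space, every object as a
   finite-dimensional one over the division ring End(S). *)
Definition line_generator : Prop :=
  [/\ idm S != 0,
      forall c : mor S S, c != 0 ->
        exists c', c' \cm c = idm S /\ c \cm c' = idm S
    & forall X, exists n (f : 'I_n -> mor S X) (q : 'I_n -> mor X S),
        (forall j k, q j \cm f k = if j == k then idm S else 0) /\
        \sum_j f j \cm q j = idm X].

Lemma in_nonzeros X I (e : I -> mor S X) i : (i \in nonzeros e) = (e i != 0).
Proof. by rewrite inE. Qed.

Hypothesis gS : line_generator.

Lemma line_integral X (v : mor S X) (c : mor S S) :
  v \cm c = 0 -> v = 0 \/ c = 0.
Proof.
move=> vc0; case: gS => _ inv _; case: (eqVneq c 0) => [->|]; first by right.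
move=> /inv[c' [_ cc']]; left.
by rewrite -(compm1 v) -cc' compmA vc0 comp0m.
Qed.

Lemma line_eqm X Y (f g : mor X Y) :
  (forall v : mor S X, f \cm v = g \cm v) -> f = g.
Proof.
move=> fg; case: gS => _ _ /(_ X)[n [u [q [_ uq]]]].
rewrite -(compm1 f) -(compm1 g) -uq !comp_sumr.
by apply: eq_bigr => i _; rewrite !compmA fg.
Qed.

(** The [i]-th functional collects the [i]-th coordinates along [e] of a reference basis [f],
    weighted by the functionals dual to [f]. *)
Lemma basis_dual X I (e : I -> mor S X) : is_basis e -> exists p, is_dual e p.
Proof.
move=> [e_indep e_spans]; case: gS => _ _ /(_ X)[n [f [q [qf fq]]]].
have [a fE] := choice (fun k => e_spans (f k)).
pose p i : mor X S := if e i == 0 then 0 else \sum_k a k i \cm q k.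
have epE : \sum_i e i \cm p i = idm X.
  rewrite -fq (eq_bigr (fun k => \sum_i e i \cm (a k i \cm q k))); last first.
    move=> k _; rewrite {1}fE comp_suml.
    by apply: eq_bigr => i _; rewrite compmA.
  rewrite exchange_big; apply: eq_bigr => i _; rewrite /p.
  case: eqP => [->|_]; last by rewrite comp_sumr.
  by rewrite comp0m big1 // => k _; rewrite comp0m.
exists p; split=> // [i j|i ei0]; last by rewrite /p ei0 eqxx.
have /e_indep/(_ i) : \sum_k e k \cm
    (p k \cm e j - (if k == j then idm S else 0)) = 0.
  rewrite (eq_bigr (fun k => (e k \cm p k) \cm e j -
      e k \cm (if k == j then idm S else 0))); last first.
    by move=> k _; rewrite compBr compmA.
  rewrite sumrB -comp_suml epE comp1m (bigD1 j) //= eqxx compm1.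
  rewrite big1 ?addr0 ?subrr // => k /negPf ->; exact: compm0.
case: (eqVneq (e i) 0) => [ei0 _|ei0].
  by rewrite andbF /p ei0 eqxx comp0m.
move/line_integral => [/eqP|/eqP]; first by rewrite (negPf ei0).
by rewrite andbT subr_eq0 => /eqP.
Qed.

Lemma dual_basis X I (e : I -> mor S X) p : is_dual e p -> is_basis e.
Proof.
move=> [pe p0 ep]; split=> [c ec0 i|v]; last first.
  exists (fun i => p i \cm v); rewrite -{1}(comp1m v) -ep comp_suml.
  by apply: eq_bigr => i _; rewrite compmA.
case: (eqVneq (e i) 0) => [->|ei0]; first exact: comp0m.
have := congr1 (fun w => p i \cm w) ec0.
rewrite compm0 comp_sumr (bigD1 i) //= compmA pe eqxx ei0 comp1m big1 ?addr0.
  by move=> ->; rewrite compm0.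
by move=> j; rewrite eq_sym compmA pe => /negPf ->; rewrite comp0m.
Qed.

Lemma basis_eqm X Y I (e : I -> mor S X) (f g : mor X Y) :
  spans e -> (forall i, f \cm e i = g \cm e i) -> f = g.
Proof.
move=> e_spans fg; apply: line_eqm => v; have [c ->] := e_spans v.
by rewrite !comp_sumr; apply: eq_bigr => i _; rewrite !compmA fg.
Qed.

(** Gaussian elimination: [Q] indexes the equations, [P] the unknowns allowed to be nonzero.
    Equation [j0] either determines an unknown [i0] or is trivial on [P]; both times the induction
    drops it. *)
Lemma lin_dep I J (P : {set I}) (Q : {set J}) (A : J -> I -> mor S S) :
  (#|Q| < #|P|)%N ->
  exists c : I -> mor S S,
    [/\ forall i, i \notin P -> c i = 0, exists i, c i != 0
      & forall j, j \in Q -> \sum_i A j i \cm c i = 0].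
Proof.
elim: {Q}#|Q| {-2}Q (erefl #|Q|) P A => [|n IHn] Q cQ P A QP.
  rewrite cQ in QP; have /card_gt0P[i0 Pi0] := QP.
  exists (fun i => if i == i0 then idm S else 0); split.
  - by move=> i; case: eqP => // ->; rewrite Pi0.
  - by exists i0; rewrite eqxx; case: gS.
  - by move=> j; rewrite (cards0_eq cQ) inE.
have /card_gt0P[j0 Qj0] : (0 < #|Q|)%N by rewrite cQ.
have cQ' : #|Q :\ j0| = n by have := cardsD1 j0 Q; rewrite Qj0 cQ => -[].
have [/existsP[i0 /andP[Pi0 Aji0]]|] :=
    boolP [exists i0, (i0 \in P) && (A j0 i0 != 0)].
  case: gS => _ /(_ _ Aji0)[b [bA Ab]] _.
  (* The system after substituting the value that equation [j0] forces on the unknown [i0]. *)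
  pose A' j i := A j i - A j i0 \cm b \cm A j0 i.
  have [|c [cP [i1 ci1] cQ0]] := IHn _ cQ' (P :\ i0) A'.
    by move: QP; rewrite cQ (cardsD1 i0 P) Pi0 cQ'.
  have ci0 : c i0 = 0 by apply: cP; rewrite !inE eqxx.
  pose x := \sum_i A j0 i \cm c i.
  pose c' i := if i == i0 then - (b \cm x) else c i.
  have sumE j : \sum_i A j i \cm c' i = \sum_i A' j i \cm c i
      + A j i0 \cm b \cm x - A j i0 \cm b \cm x.
    rewrite (bigD1 i0) //= /c' eqxx compmN compmA addrC; congr (_ - _).
    rewrite [in RHS]/x [in RHS]comp_sumr -big_split /=.
    rewrite [RHS](bigD1 i0) //= ci0 !compm0 !add0r.
    apply: eq_bigr => i /negPf ->.
    by rewrite /A' compBl !compmA subrK.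
  exists c'; split.
  - move=> i Pi; rewrite /c'; case: (eqVneq i i0) => [ii0|ne].
      by rewrite ii0 Pi0 in Pi.
    by apply: cP; rewrite !inE ne.
  - exists i1; rewrite /c'; case: (eqVneq i1 i0) => [ii0|//].
    by rewrite ii0 ci0 eqxx in ci1.
  move=> j Qj; rewrite sumE addrK; case: (eqVneq j j0) => [->|ne].
    by rewrite big1 // => i _; rewrite /A' Ab comp1m subrr comp0m.
  by apply: cQ0; rewrite !inE ne.
rewrite negb_exists => /forallP A0.
have [|c [cP c0 cQ0]] := IHn _ cQ' P A.
  by rewrite cQ'; apply: ltn_trans QP; rewrite cQ.
exists c; split=> // j Qj; case: (eqVneq j j0) => [->|ne]; last first.
  by apply: cQ0; rewrite !inE ne.
rewrite big1 // => i _; have := A0 i; rewrite negb_and negbK.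
by case/orP => [/cP ->|/eqP ->]; rewrite ?compm0 ?comp0m.
Qed.

(** Steinitz: with more nonzero [e i] than nonzero [f j], the coordinates of the [e i] would satisfy
    a nontrivial relation supported on nonzero vectors. *)
Lemma indep_card_le X I J (e : I -> mor S X) (f : J -> mor S X) :
  indep e -> spans f ->
  (#|nonzeros e| <= #|nonzeros f|)%N.
Proof.
move=> e_indep f_spans; rewrite leqNgt; apply/negP => lt_fe.
have [a eE] := choice (fun i => f_spans (e i)).
have [c [cP [i ci] c0]] := lin_dep (fun j i => a i j) lt_fe.
have /e_indep/(_ i)/line_integral[/eqP|/eqP] : \sum_i e i \cm c i = 0.
- rewrite (eq_bigr (fun i => \sum_j f j \cm (a i j \cm c i))); last first.
    move=> k _; rewrite {1}eE comp_suml.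
    by apply: eq_bigr => j _; rewrite compmA.
  rewrite exchange_big big1 // => j _; rewrite -comp_sumr.
  case: (eqVneq (f j) 0) => [->|fj]; first exact: comp0m.
  by rewrite c0 ?compm0 ?in_nonzeros.
- by move/eqP=> ei0; move: ci; rewrite cP ?eqxx // in_nonzeros ei0 eqxx.
- exact/negP.
Qed.

Lemma basis_card X I J (e : I -> mor S X) (f : J -> mor S X) :
  is_basis e -> is_basis f ->
  #|nonzeros e| = #|nonzeros f|.
Proof.
by move=> [ei es] [fi fs]; apply/eqP; rewrite eqn_leq !indep_card_le.
Qed.

Lemma exists_basis X : exists n (f : 'I_n -> mor S X), is_basis f.
Proof.
case: gS => S0 _ /(_ X)[n [f [q [qf fq]]]]; exists n, f.
have f0 i : f i != 0.
  by apply: contra_neq S0 => fi; rewrite -[RHS](compm0 S (q i)) -fi qf eqxx.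
apply: (@dual_basis _ _ _ q); split=> // [i j|i /eqP].
  by rewrite qf f0 andbT.
by rewrite (negPf (f0 i)).
Qed.

Definition join_family X I J (e : I -> mor S X) (f : J -> mor S X)
  (k : I + J) : mor S X := match k with inl i => e i | inr j => f j end.

Lemma sum_join X I J (e : I -> mor S X) (f : J -> mor S X)
    (c : I + J -> mor S S) :
  \sum_k join_family e f k \cm c k =
  \sum_i e i \cm c (inl i) + \sum_j f j \cm c (inr j).
Proof. by rewrite big_sumType. Qed.

(** A maximal part [A] of a full basis that stays independent of [e] completes it. Vectors outside
    [A] are set to 0, so the index type does not depend on [A]. *)
Lemma indep_extend X I (e : I -> mor S X) : indep e ->
  exists (J : finType) (f : J -> mor S X), is_basis (join_family e f).
Proof.
move=> e_indep; have [n [f [f_indep f_spans]]] := exists_basis X.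
pose g (A : {set 'I_n}) j := if j \in A then f j else 0.
pose good (A : {set 'I_n}) := `[< indep (join_family e (g A)) >].
have good0 : good finset.set0.
  apply/asboolP => c; rewrite sum_join [X in _ + X]big1 ?addr0; last first.
    by move=> j _; rewrite /g inE comp0m.
  move/e_indep => ec [i|j] /=; first exact: (ec i).
  by rewrite /g inE comp0m.
have [A /maxsetP[/asboolP goodA maxA] _] := maxset_exists good0.
exists 'I_n, (g A); split=> // v.
suff fS k : exists c, f k = \sum_i join_family e (g A) i \cm c i.
  have [a fE] := choice fS; have [b ->] := f_spans v.
  exists (fun i => \sum_k a k i \cm b k).
  rewrite (eq_bigr (fun k => \sum_i join_family e (g A) i \cm (a k i \cm b k))).
    by rewrite exchange_big; apply: eq_bigr => i _; rewrite comp_sumr.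
  move=> k _; rewrite {1}fE comp_suml.
  by apply: eq_bigr => i _; rewrite compmA.
case: (boolP (k \in A)) => kA.
  exists (fun i => if i == inr k then idm S else 0).
  rewrite (bigD1 (inr k)) //= eqxx compm1 /g kA big1 ?addr0 //.
  by move=> i /negPf ->; rewrite compm0.
(* By maximality, adding [f k] creates a relation. Its coefficient at [f k] is nonzero since [goodA]
   excludes relations without [f k]; dividing by it expresses [f k]. *)
have : ~ indep (join_family e (g (k |: A)%SET)).
  move=> /asboolP gkA; have /finset.setP/(_ k) := maxA _ gkA (finset.subsetU1 _ _).
  by rewrite !inE eqxx (negPf kA).
move=> /existsNP[c] /not_implyP[c0] /existsNP[i ci].
have sumE : \sum_i join_family e (g (k |: A)%SET) i \cm c i =
    \sum_i join_family e (g A) i \cm c i + f k \cm c (inr k).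
  rewrite !sum_join -addrA; congr (_ + _).
  rewrite (bigD1 k) //= [in RHS](bigD1 k) //= /g finset.setU11 (negPf kA) comp0m.
  rewrite add0r addrC; congr (_ + _); apply: eq_bigr => j jk.
  by rewrite !inE (negPf jk).
have [ck0|ck0] := eqVneq (c (inr k)) 0.
  move: c0; rewrite sumE ck0 compm0 addr0 => /goodA/(_ i).
  case: i ci => [i|j] //=; rewrite /g !inE.
  by case: (eqVneq j k) => [->|_] //=; rewrite ck0 compm0.
case: gS => _ /(_ _ ck0)[b [bc cb]] _.
exists (fun i => - (c i \cm b)).
move: c0; rewrite sumE => /eqP; rewrite addrC addr_eq0 => /eqP fk.
rewrite -[LHS]compm1 -cb compmA fk compNm comp_suml -sumrN.
by apply: eq_bigr => j _; rewrite compmN compmA.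
Qed.

End Families.

(** * Length is dimension *)

Lemma sum_unit (V : nmodType) (f : unit -> V) : \sum_u f u = f tt.
Proof. by rewrite (bigD1 tt) //= big1 ?addr0 // => -[]. Qed.

Section Length.
Variable D : abelian_category.
Implicit Types X Y : D.

(** The kernel of [c] is a subobject of [S], hence 0 or everything. In the first case [c] is mono
    and simplicity makes it invertible; in the second [c] is 0. *)
Lemma schur (S : D) : simple_object S -> forall c : mor S S, c != 0 ->
  exists c', c' \cm c = idm S /\ c \cm c' = idm S.
Proof.
move=> [S0 simS] c c0; have [K [k kK]] := has_kernels c.
have [K0|[k' [_ kk']]] := simS _ _ (kernel_mono kK).
  have mc : mono c.
    apply: mono0 => Z g cg0; have [_ /(_ Z g cg0)[u [<- _]]] := kK.
    by rewrite ((K0 _).2 u 0) compm0.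
  by have [|[c' [? ?]]] := simS _ _ mc; last by exists c'.
case/negP: c0; apply/eqP; have [ck0 _] := kK.
by rewrite -(compm1 c) -kk' compmA ck0 comp0m.
Qed.

Lemma simple_line_generator (S : D) : semisimple D -> simple_object S ->
  (forall S' : D, simple_object S' -> isomorphic S S') -> line_generator S.
Proof.
move=> ssD simS uniS; split; last 1 first.
- move=> X; have [n [T [simT [i [p [pi pi0 ip]]]]]] := ssD X.
  pose iso j := cid (uniS _ (simT j)); pose f j := projT1 (iso j).
  pose iso' j := cid (projT2 (iso j)); pose g j := projT1 (iso' j).
  have fg j : g j \cm f j = idm S /\ f j \cm g j = idm (T j).
    exact: projT2 (iso' j).
  exists n, (fun j => i j \cm f j), (fun j => g j \cm p j); split=> [j k|].
    case: eqP => [->|/eqP jk].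
      by rewrite compmA -(compmA (g k)) pi compm1 (fg k).1.
    by rewrite compmA -(compmA (g j)) pi0 // compm0 comp0m.
  rewrite -ip; apply: eq_bigr => j _.
  by rewrite compmA -(compmA (i j)) (fg j).2 compm1.
- by apply: contra_notN simS.1 => /eqP /is_zeroP.
- exact: schur.
Qed.

(** A mono is the kernel of some [g]. As [g] factors through the cokernel [q], whatever [q] kills is
    killed by [g] and factors through the mono. *)
Lemma mono_factor X Y Q (m : mor X Y) (q : mor Y Q) : mono m ->
  is_cokernel m q -> forall Z (u : mor Z Y), q \cm u = 0 ->
  exists w, m \cm w = u.
Proof.
move=> mm [_ qP] Z u qu0; have [W [g [gm gP]]] := mono_normal mm.
have [h [hq _]] := qP _ _ gm.
have [|w [mw _]] := gP _ u; first by rewrite -hq -compmA qu0 compm0.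
by exists w.
Qed.

Variables (S : D) (gS : line_generator S) (simS : simple_object S).

Lemma nonzeros_join X (I J : finType) (e : I -> mor S X) (f : J -> mor S X) :
  #|nonzeros (join_family e f)| = (#|nonzeros e| + #|nonzeros f|)%N.
Proof.
by rewrite -!sum1_card big_sumType; congr (_ + _)%N; apply: eq_bigl => i;
  rewrite !inE.
Qed.

Lemma basis_direct_sum X (I : finType) (e : I -> mor S X) : is_basis e ->
  is_direct_sum (fun _ : 'I_#|nonzeros e| => S) X.
Proof.
move=> /(basis_dual gS)[p [pe p0 ep]].
exists (fun k => e (enum_val k)), (fun k => p (enum_val k)); split.
- by move=> k; rewrite pe eqxx -in_nonzeros enum_valP.
- by move=> j k jk; rewrite pe (inj_eq enum_val_inj) (negPf jk).
- rewrite -(big_enum_val (fun i => e i \cm p i)) /= -ep big_mkcond /=.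
  apply: eq_bigr => i _; rewrite in_nonzeros.
  by case: eqP => //= ->; rewrite comp0m.
Qed.

Lemma iso_basis X Y (I : finType) (e : I -> mor S X) (f : mor X Y) :
  is_iso f -> is_basis e -> is_basis (fun i => f \cm e i).
Proof.
move=> [g [gf fg]] [e_indep e_spans]; split=> [c fc0 i|v].
  rewrite -compmA e_indep ?compm0 //.
  rewrite -(comp1m (\sum_i _)) -gf -compmA comp_sumr.
  by rewrite (eq_bigr _ (fun i _ => compmA _ _ _)) fc0 compm0.
have [c gv] := e_spans (g \cm v); exists c.
rewrite -(comp1m v) -fg -compmA gv comp_sumr.
by apply: eq_bigr => i _; rewrite compmA.
Qed.

Lemma mono_nonzeros X Y (I : finType) (e : I -> mor S X) (f : mor X Y) :
  mono f -> nonzeros (fun i => f \cm e i) = nonzeros e.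
Proof.
move=> mf; apply/finset.setP => i; rewrite !in_nonzeros; congr (~~ _).
apply/eqP/eqP => [/(mono_eq0 mf)//|->]; exact: compm0.
Qed.

Lemma iso_mono X Y (f : mor X Y) : is_iso f -> mono f.
Proof.
move=> [g [gf _]]; apply: mono0 => Z u fu0.
by rewrite -(comp1m u) -gf -compmA fu0 compm0.
Qed.

(** The chain consists of the sums of [k] copies of [S], included as the first [k] coordinates; the
    last coordinate is the cokernel of each inclusion. *)
Lemma direct_sum_length n X :
  is_direct_sum (fun _ : 'I_n => S) X -> has_length X n.
Proof.
have [Z ZP] := choice (fun k => has_direct_sums (fun _ : 'I_k => S)).
pose i k := projT1 (cid (ZP k)); pose iP k := cid (projT2 (cid (ZP k))).
pose p k := projT1 (iP k); have ipP k := projT2 (iP k).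
move=> [iX [pX [pX1 pX0 ipX]]].
have pK k (a b : 'I_k) : p k a \cm i k b = if a == b then idm S else 0.
  case: eqP => [->|/eqP ab]; first by have [pi1 _ _] := ipP k; exact: pi1.
  by have [_ pi0 _] := ipP k; exact: pi0.
have ipK k : \sum_j i k j \cm p k j = idm (Z k) by have [_ _ ip1] := ipP k.
pose w k (j : 'I_k) : 'I_k.+1 := widen_ord (leqnSn k) j.
pose m k : mor (Z k) (Z k.+1) := \sum_(j < k) i k.+1 (w k j) \cm p k j.
have pm k (j : 'I_k) : p k.+1 (w k j) \cm m k = p k j.
  rewrite comp_sumr (bigD1 j) //= compmA pK eqxx comp1m big1 ?addr0 // => l lj.
  by rewrite compmA pK -val_eqE /= val_eqE eq_sym (negPf lj) comp0m.
have mi k (j : 'I_k) : m k \cm i k j = i k.+1 (w k j).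
  rewrite comp_suml (bigD1 j) //= -compmA pK eqxx compm1 big1 ?addr0 // => l lj.
  by rewrite -compmA pK (negPf lj) compm0.
have wmax k (j : 'I_k) : (ord_max == w k j) = false.
  by apply/eqP => /(congr1 val)/= kj; have := ltn_ord j; rewrite -kj ltnn.
exists Z, m; split.
- by apply/is_zeroP; rewrite -ipK big_ord0.
- exists (\sum_j iX j \cm p n j), (\sum_j i n j \cm pX j); split.
    rewrite -ipK comp_suml; apply: eq_bigr => j _.
    rewrite -compmA comp_sumr (bigD1 j) //= compmA pX1 comp1m big1 ?addr0 //.
    by move=> l lj; rewrite compmA pX0 ?comp0m // eq_sym.
  rewrite -ipX comp_suml; apply: eq_bigr => j _.
  rewrite -compmA comp_sumr (bigD1 j) //= compmA pK eqxx comp1m big1 ?addr0 //.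
  by move=> l lj; rewrite compmA pK eq_sym (negPf lj) comp0m.
move=> k _; split.
  apply: mono0 => W g mg0; rewrite -(comp1m g) -ipK comp_suml big1 // => j _.
  by rewrite -pm -!compmA mg0 !compm0.
exists S, (p k.+1 ord_max); split=> //; split.
  rewrite comp_sumr big1 // => j _.
  by rewrite compmA pK wmax comp0m.
move=> W g gm0; exists (g \cm i k.+1 ord_max); split.
  rewrite -[RHS]compm1 -ipK big_ord_recr compDr /= comp_sumr big1; last first.
    by move=> j _; rewrite -/(w k j) -mi !compmA gm0 !comp0m.
  by rewrite add0r compmA.
by move=> h <-; rewrite -compmA pK eqxx compm1.
Qed.

(** The extension splits: [t \cm q] cannot vanish on a whole basis of [Y], and dividing by a nonzero
    value gives a section [s]. *)
Lemma simple_extension X Y Q (I : finType) (e : I -> mor S X) (m : mor X Y)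
    (q : mor Y Q) :
  mono m -> is_cokernel m q -> isomorphic S Q -> is_basis e ->
  exists s : unit -> mor S Y,
    is_basis (join_family (fun i => m \cm e i) s) /\ #|nonzeros s| = 1%N.
Proof.
move=> mm cq [t' [t [tt' t't]]] [e_indep e_spans].
have [n [f [f_indep f_spans]]] := exists_basis gS Y.
have [S0 inv _] := gS; have qm : (t \cm q) \cm m = 0.
  by rewrite -compmA cq.1 compm0.
have [j qf] : exists j, t \cm q \cm f j != 0.
  apply: contrapT => /forallNP qf0.
  have q0 : t \cm q = 0.
    apply: (basis_eqm gS f_spans) => j; rewrite comp0m.
    by have /negP := qf0 j; rewrite negbK => /eqP.
  case/eqP: S0; rewrite -tt'.
  have -> : t = 0 by apply: (cokernel_epi cq); rewrite q0 comp0m.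
  exact: comp0m.
have [b [_ qfb]] := inv _ qf.
have [s qs] : exists s : mor S Y, t \cm q \cm s = idm S.
  by exists (f j \cm b); rewrite compmA.
exists (fun=> s); split; last first.
  apply/eqP; rewrite eqn_leq; apply/andP; split.
    by apply: leq_trans (max_card _) _; rewrite card_unit.
  apply/card_gt0P; exists tt; rewrite in_nonzeros.
  by apply: contra_neq S0 => s0; rewrite -qs s0 compm0.
split=> [c|v].
  rewrite sum_join sum_unit => sum0.
  have c0 : c (inr tt) = 0.
    have := congr1 (fun w => t \cm q \cm w) sum0.
    rewrite compm0 compDr compmA qs comp1m comp_sumr big1 ?add0r // => i _.
    by rewrite !compmA qm !comp0m.
  move: sum0; rewrite c0 compm0 addr0 => sum0 [i|[]] /=; last first.
    by rewrite c0 compm0.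
  rewrite -compmA (e_indep (fun i => c (inl i))) ?compm0 //.
  apply: (mono_eq0 mm); rewrite comp_sumr -[RHS]sum0.
  by apply: eq_bigr => k _; rewrite compmA.
have [|u mu] := mono_factor mm cq (u := v - s \cm (t \cm q \cm v)).
  apply: (mono_eq0 (f := t)); first by apply: iso_mono; exists t'.
  by rewrite compmA compBr !compmA qs comp1m subrr.
have [c uE] := e_spans u.
exists (fun k => if k is inl i then c i else t \cm q \cm v).
rewrite sum_join sum_unit.
apply/eqP; rewrite -subr_eq -mu uE comp_sumr; apply/eqP.
by apply: eq_bigr => i _; rewrite compmA.
Qed.

Hypothesis uniS : forall S' : D, simple_object S' -> isomorphic S S'.

Lemma has_length_basis X n : has_length X n ->
  exists (I : finType) (e : I -> mor S X), is_basis e /\ #|nonzeros e| = n.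
Proof.
move=> [Z [m [Z0 [f fiso] mP]]].
suff /(_ n (leqnn n))[I [e [eb <-]]] : forall k, (k <= n)%N ->
    exists (I : finType) (e : I -> mor S (Z k)), is_basis e /\ #|nonzeros e| = k.
  exists I, (fun i => f \cm e i); split; first exact: iso_basis.
  by rewrite mono_nonzeros //; exact: iso_mono.
elim=> [_|k IHk kn].
  exists void, (fun v : void => match v with end); split; first split.
  - by move=> c _ [].
  - by move=> v; exists (fun=> 0); rewrite big1 => [|[]//]; apply: (Z0 _).2.
  - by apply: eq_card0 => -[].
have [I [e [eb ek]]] := IHk (ltnW kn).
have [mm [Q [q [cq simQ]]]] := mP _ kn.
have [s [sb s1]] := simple_extension mm cq (uniS simQ) eb.
exists (I + unit)%type, (join_family (fun i => m k \cm e i) s); split=> //.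
by rewrite nonzeros_join s1 addn1 mono_nonzeros // ek.
Qed.

(** Every chain yields a basis with as many nonzero vectors, so the invariance of that number takes
    the place of the Jordan-Hoelder theorem. *)
Lemma length_basis X (I : finType) (e : I -> mor S X) :
  is_basis e -> length X = #|nonzeros e|.
Proof.
move=> eb; apply: xget_subset1.
  exact/direct_sum_length/basis_direct_sum.
have lenE n : has_length X n -> n = #|nonzeros e|.
  by move=> /has_length_basis[J [f [fb <-]]]; exact: (basis_card gS fb eb).
by move=> m n /lenE -> /lenE ->.
Qed.

(** The nonzero [f \cm e i] are independent, being members of [h]; their lifts to the image form a
    basis of it. *)
Lemma length_im X Y (f : mor X Y) (I : finType) (e : I -> mor S X)
    (h : I -> mor S Y) :
  is_basis e -> is_basis h -> (forall i, e i != 0 -> f \cm e i = h i) ->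
  length (im f) = #|nonzeros (fun i => f \cm e i)|.
Proof.
move=> eb hb feh; rewrite /im; case: cid => K /= [m [Q [q [cq kq]]]].
have mm := kernel_mono kq.
have /choice[k kE] : forall i, exists k : mor S K, m \cm k = f \cm e i.
  move=> i; have [|k [mk _]] := kq.2 _ (f \cm e i); last by exists k.
  by rewrite compmA cq.1 comp0m.
have -> : nonzeros (fun i => f \cm e i) = nonzeros k.
  by rewrite -(mono_nonzeros _ mm); congr nonzeros; apply/funext => i; rewrite kE.
have [p [pe p0 hp]] := basis_dual gS hb.
have fe i : f \cm e i = if e i == 0 then 0 else h i.
  by case: eqP => [->|/eqP]; [exact: compm0 | exact: feh].
apply: length_basis; split=> [c kc0 i|v].
  apply: (mono_eq0 mm); rewrite compmA kE fe.
  have : \sum_i h i \cm (if e i == 0 then 0 else c i) = 0.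
    rewrite -[RHS](compm0 _ m) -kc0 comp_sumr; apply: eq_bigr => j _.
    by rewrite compmA kE fe; case: ifP => _; rewrite ?comp0m ?compm0.
  move=> /hb.1/(_ i); case: eqP => // _ _; exact: comp0m.
(* Here [p i] kills [f], so it factors through the cokernel [q] and kills the kernel [m] of [q]. *)
have pm i : e i = 0 -> p i \cm m = 0.
  move=> ei0; have pf : p i \cm f = 0.
    apply: (basis_eqm gS eb.2) => j; rewrite comp0m -compmA fe.
    case: eqP => [_|/eqP ej]; first exact: compm0.
    by rewrite pe; case: eqP => //= ij; move: ej; rewrite -ij ei0 eqxx.
  by have [u [<- _]] := cq.2 _ _ pf; rewrite -compmA kq.1 compm0.
exists (fun i => p i \cm m \cm v).
apply: mm; rewrite -(comp1m (m \cm v)) -hp comp_suml comp_sumr.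
apply: eq_bigr => i _; rewrite (compmA m) kE fe.
case: eqP => [ei0|_]; last by rewrite !compmA.
by rewrite comp0m -compmA (compmA (p i)) pm // comp0m compm0.
Qed.

End Length.

(** * Elimination *)

Section Elimination.
Variables (C : preadditive) (S : C) (gS : line_generator S).
Variables (T : Type) (le : T -> T -> Prop) (V : T -> C).
Variables (tr : forall s t, le s t -> mor (V s) (V t)).
Variables (W : C) (phi : forall t, mor (V t) W).
Hypothesis le_total : forall s t, le s t \/ le t s.
Hypothesis phi_tr : forall s t (h : le s t), phi t \cm tr h = phi s.
Variable I : finType.
Implicit Types (e : forall t, I -> mor S (V t)) (g : I -> mor S W).

Definition compatible_bases e : Prop :=
  (forall t, is_basis (e t)) /\
  forall s t (h : le s t) i, e s i != 0 -> tr h \cm e s i = e t i.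

Definition lies_over e g : Prop :=
  forall t i, e t i != 0 -> phi t \cm e t i = g i.

(** The vectors in a relation among the [g i] survive up to [W], so their lifetimes are nested
    up-sets of [T]. The one with the smallest lifetime is replaced by the relation itself: over [V]
    this is a change of basis, and at [W] the new vector is 0. *)
Lemma eliminate_relation e g : compatible_bases e -> lies_over e g ->
  ~ indep g -> exists e' g', [/\ compatible_bases e', lies_over e' g'
                             & (#|nonzeros g'| < #|nonzeros g|)%N].
Proof.
move=> [eb etr] eg /existsNP[c0] /not_implyP[gc0] /existsNP[i1 gci1].
pose c i := if g i == 0 then 0 else c0 i.
have gc : \sum_i g i \cm c i = 0.
  rewrite -[RHS]gc0; apply: eq_bigr => i _; rewrite /c.
  by case: eqP => // ->; rewrite !comp0m.
have cg i : c i != 0 -> g i != 0.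
  by rewrite /c; case: ifP => // _; rewrite eqxx.
have ci1 : c i1 != 0.
  rewrite /c; case: (eqVneq (g i1) 0) => [gi|_].
    by case: gci1; rewrite gi comp0m.
  by apply: contra_notN gci1 => /eqP ->; rewrite compm0.
have up i s t : le s t -> c i != 0 -> e s i != 0 -> e t i != 0.
  move=> st /cg gi si; apply: contra_neq gi => ti.
  by rewrite -(eg s i si) -(phi_tr st) -compmA etr // ti compm0.
(* the youngest basis vector occurring in the relation *)
have [i0 ci0 young] : exists2 i0, c i0 != 0 &
    forall j t, c j != 0 -> e t i0 != 0 -> e t j != 0.
  (* Lifetimes being nested, the vector with the most older companions is the youngest. *)
  pose older i : pred I := fun j =>
    (c j != 0) && `[< forall t, e t i != 0 -> e t j != 0 >].
  have [i0 ci0 maxi0] :=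
    @arg_maxnP I i1 (fun i => c i != 0) (fun i => #|older i|) ci1.
  exists i0 => // j t cj ti0; apply: contraT; rewrite negbK => /eqP tj.
  have : (#|older j| <= #|older i0|)%N := maxi0 j cj.
  rewrite leqNgt => /negP[]; apply: proper_card.
  apply/properP; split; last first.
    exists j; first by rewrite /older unfold_in cj /=; apply/asboolP.
    rewrite unfold_in cj /=; apply/asboolP => /(_ t ti0).
    by rewrite tj eqxx.
  apply/fintype.subsetP => k /andP[ck /asboolP ki0]; apply/andP; split=> //.
  apply/asboolP => s sj; apply: ki0.
  have [ts|st] := le_total t s; first exact: up ts ci0 ti0.
  by have := up _ _ _ st cj sj; rewrite tj eqxx.
pose e' t i :=
  if (i == i0) && (e t i0 != 0) then \sum_j e t j \cm c j else e t i.
pose g' i := if i == i0 then 0 else g i.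
exists e', g'; split; last 1 first.
- have -> : nonzeros g' = (nonzeros g :\ i0)%SET.
    apply/finset.setP => i; rewrite !inE /g'.
    by case: (i == i0) => //=; rewrite eqxx.
  by rewrite [X in (_ < X)%N](cardsD1 i0) in_nonzeros cg.
- split=> [t|s t st i].
    case: (eqVneq (e t i0) 0) => [ti0|ti0].
      by rewrite (_ : e' t = e t) //; apply/funext => i; rewrite /e' ti0 eqxx andbF.
    (* In coordinates the replacement is a triangular substitution, invertible because [c i0] is. *)
    have e'E (x : I -> mor S S) : \sum_i e' t i \cm x i =
        \sum_i e t i \cm (c i \cm x i0 + if i == i0 then 0 else x i).
      rewrite (bigD1 i0) //= {1}/e' eqxx ti0 /= comp_suml.
      rewrite (eq_bigr (fun i => e t i \cm (c i \cm x i0) +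
          e t i \cm (if i == i0 then 0 else x i)) (fun i _ => compDr _ _ _)).
      rewrite big_split /=; congr (_ + _).
        by apply: eq_bigr => i _; rewrite compmA.
      rewrite [RHS](bigD1 i0) //= eqxx compm0 add0r.
      by apply: eq_bigr => i /negPf ii0; rewrite /e' ii0.
    have [e_indep e_spans] := eb t; split=> [x|v].
      rewrite e'E => /e_indep ex; have := ex i0; rewrite eqxx addr0.
      move=> /(line_integral gS)[/eqP|]; first by rewrite (negPf ti0).
      move=> /(line_integral gS)[/eqP|xi0]; first by rewrite (negPf ci0).
      move=> i; rewrite /e'; have := ex i; rewrite xi0 compm0 add0r.
      by case: (eqVneq i i0) => [->|//]; rewrite xi0 !compm0.
    have [a ->] := e_spans v; have [_ /(_ _ ci0)[b [_ cb]] _] := gS.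
    exists (fun i => if i == i0 then b \cm a i0 else a i - c i \cm (b \cm a i0)).
    rewrite e'E eqxx; apply: eq_bigr => i _; congr (_ \cm _).
    case: (eqVneq i i0) => [->|_]; first by rewrite compmA cb comp1m addr0.
    by rewrite addrC subrK.
  rewrite /e'; case: (eqVneq i i0) => [-> /=|_ /=]; last exact: etr.
  case: (eqVneq (e s i0) 0) => [->|si0 _]; first by rewrite eqxx.
  rewrite (up _ _ _ st ci0 si0) comp_sumr; apply: eq_bigr => j _.
  case: (eqVneq (c j) 0) => [->|cj]; first by rewrite !compm0.
  by rewrite compmA etr // young.
- move=> t i; rewrite /e' /g'; case: (eqVneq i i0) => [-> /=|_ /=]; last exact: eg.
  case: (eqVneq (e t i0) 0) => [->|ti0 _]; first by rewrite eqxx.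
  rewrite comp_sumr -[RHS]gc; apply: eq_bigr => j _.
  case: (eqVneq (c j) 0) => [->|cj]; first by rewrite !compm0.
  by rewrite compmA eg // young.
Qed.

Lemma eliminate e : compatible_bases e ->
  exists e' g, [/\ compatible_bases e', lies_over e' g & indep g].
Proof.
move=> ec.
have [g eg] : exists g, lies_over e g.
  suff /choice[g gP] : forall i, exists g : mor S W,
      forall t, e t i != 0 -> phi t \cm e t i = g by exists g => t i; exact: gP.
  move=> i; have [[t ti]|/forallNP noi] := pselect (exists t, e t i != 0); last first.
    by exists 0 => t /noi.
  exists (phi t \cm e t i).
  suff H u v : le u v -> e u i != 0 -> e v i != 0 ->
      phi u \cm e u i = phi v \cm e v i.
    by move=> s si; have [st|ts] := le_total s t; [exact: H | apply/esym/H].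
  by move=> uv ui vi; rewrite -(phi_tr uv) -compmA ec.2.
have [n] := ubnP #|nonzeros g|; elim: n => // n IHn in e g ec eg *.
move=> gn; have [g_indep|ng] := pselect (indep g); first by exists e, g.
have [e' [g' [ec' eg' lt_g]]] := eliminate_relation ec eg ng.
by apply: (IHn e' g') => //; apply: leq_trans lt_g _.
Qed.

End Elimination.

(** * Morphisms bijective on points *)

Section Bijective.
Variables (C : preadditive) (S : C) (gS : line_generator S).
Implicit Types X Y : C.

Definition point_bijective X Y (f : mor X Y) : Prop :=
  (forall v : mor S X, f \cm v = 0 -> v = 0) /\
  forall w : mor S Y, exists v, f \cm v = w.

Lemma point_bijective_id X : point_bijective (idm X).
Proof. by split=> [v|w]; [rewrite comp1m | exists w; rewrite comp1m]. Qed.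

Lemma point_bijective_comp X Y Z (g : mor Y Z) (f : mor X Y) :
  point_bijective g -> point_bijective f -> point_bijective (g \cm f).
Proof.
move=> [gi gs] [fi fs]; split=> [v|w]; first by rewrite -compmA => /gi /fi.
by have [u <-] := gs w; have [v <-] := fs u; exists v; rewrite compmA.
Qed.

Lemma point_bijective_basis X Y (f : mor X Y) (I : finType) (e : I -> mor S X) :
  point_bijective f -> is_basis e <-> is_basis (fun i => f \cm e i).
Proof.
move=> [fi fs].
have fsum (c : I -> mor S S) :
    f \cm \sum_i e i \cm c i = \sum_i f \cm e i \cm c i.
  by rewrite comp_sumr; apply: eq_bigr => i _; rewrite compmA.
split=> -[e_indep e_spans]; split=> [c ec0 i|v].
- by rewrite -compmA e_indep ?compm0 //; apply: fi; rewrite fsum.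
- by have [u <-] := fs v; have [c ->] := e_spans u; exists c; rewrite fsum.
- by apply: fi; rewrite compmA e_indep // -fsum ec0 compm0.
- have [c fv] := e_spans (f \cm v); exists c.
  by apply/eqP; rewrite -subr_eq0; apply/eqP/fi; rewrite compBr fsum fv subrr.
Qed.

End Bijective.

(** * Rank and bijectivity *)

Section Rank.
Variables (D : abelian_category) (S : D).
Variables (gS : line_generator S) (simS : simple_object S).
Hypothesis uniS : forall S' : D, simple_object S' -> isomorphic S S'.
Implicit Types X Y : D.

(** Elimination over a one-point index is column reduction of [f]. *)
Lemma adapted_basis X Y (f : mor X Y) : exists (I : finType) (e : I -> mor S X),
  is_basis e /\ indep (fun i => f \cm e i).
Proof.
have [n [e0 e0b]] := exists_basis gS X.
have [|s t _||e [g [[eb _] eg g_indep]]] :=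
    @eliminate _ _ gS unit (fun _ _ => True) (fun=> X) (fun _ _ _ => idm X) Y
      (fun=> f) _ _ 'I_n (fun=> e0).
- by left.
- exact: compm1.
- by split=> // s t _ i _; rewrite comp1m.
exists 'I_n, (e tt); split=> // c fc0 i.
have fg j : f \cm e tt j = if e tt j == 0 then 0 else g j.
  by case: eqP => [->|/eqP]; [exact: compm0 | exact: eg].
have : \sum_j g j \cm (if e tt j == 0 then 0 else c j) = 0.
  rewrite -[RHS]fc0; apply: eq_bigr => j _.
  by rewrite fg; case: ifP; rewrite ?compm0 ?comp0m.
by move=> /g_indep/(_ i); rewrite fg; case: ifP; rewrite ?comp0m.
Qed.

Lemma length_im_id X : length (im (idm X)) = length X.
Proof.
have [n [e eb]] := exists_basis gS X.
rewrite (length_im gS simS uniS eb eb) => [|i _]; last exact: comp1m.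
rewrite (length_basis gS simS uniS eb).
by congr #|pred_of_set (nonzeros _)|; apply/funext => i; rewrite comp1m.
Qed.

(** In an adapted basis the rank counts the [e i] with nonzero image. If it equals the length of
    [X], no basis vector is killed; if it equals that of [Y], completing the images to a basis adds
    only zeros. *)
Lemma length_im_bijective X Y (f : mor X Y) :
  length (im f) = length X -> length (im f) = length Y -> point_bijective S f.
Proof.
have [I [e [eb fe_indep]]] := adapted_basis f.
have [J [h hb]] := indep_extend gS fe_indep.
(* Padding by zeros gives both bases the same index type, as [length_im] requires. *)
have e0b : is_basis (join_family e (fun _ : J => 0)).
  split=> [c|v].
    rewrite sum_join [X in _ + X]big1 ?addr0 => [|j _]; last exact: comp0m.
    by move=> /eb.1 ec [i|j] /=; [exact: (ec i) | exact: comp0m].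
  have [c ->] := eb.2 v; exists (fun k => if k is inl i then c i else 0).
  by rewrite sum_join [X in _ + X]big1 ?addr0 // => j _; rewrite comp0m.
have fh k : join_family e (fun _ : J => 0) k != 0 ->
    f \cm join_family e (fun _ : J => 0) k =
    join_family (fun i => f \cm e i) h k.
  by case: k => [//|j] /=; rewrite eqxx.
have -> := length_im gS simS uniS e0b hb fh.
have -> : nonzeros (fun k => f \cm join_family e (fun _ : J => 0) k) =
    nonzeros (join_family (fun i => f \cm e i) (fun _ : J => 0)).
  by congr nonzeros; apply/funext => -[i|j] //=; rewrite compm0.
rewrite nonzeros_join (_ : nonzeros (fun _ : J => 0) = finset.set0); last first.
  by apply/finset.setP => j; rewrite !inE eqxx.
rewrite cards0 addn0.
rewrite (length_basis gS simS uniS eb) (length_basis gS simS uniS hb).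
rewrite nonzeros_join => eX eY; split=> [v|w].
  have [c ->] := eb.2 v; rewrite comp_sumr.
  rewrite (eq_bigr _ (fun i _ => compmA _ _ _)) => /fe_indep fc.
  have /eqP sub : nonzeros (fun i => f \cm e i) == nonzeros e.
    rewrite eqEcard eX leqnn andbT; apply/fintype.subsetP => i; rewrite !in_nonzeros.
    by apply: contra_neq => ->; rewrite compm0.
  rewrite big1 // => i _; have := fc i.
  move=> /(line_integral gS)[fei|->]; last exact: compm0.
  have := in_nonzeros e i; rewrite -sub in_nonzeros fei eqxx.
  move=> /esym/negbFE/eqP ->.
  exact: comp0m.
have h0 j : h j = 0.
  have : #|nonzeros h| = 0%N.
    apply/eqP; rewrite -(eqn_add2l #|nonzeros (fun i => f \cm e i)|) -eY.
    by rewrite addn0.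
  move=> /cards0_eq/finset.setP/(_ j); rewrite in_nonzeros inE.
  by move/negbFE/eqP.
have [c ->] := hb.2 w; exists (\sum_i e i \cm c (inl i)).
rewrite sum_join [X in _ + X]big1 ?addr0 => [|j _]; last by rewrite h0 comp0m.
by rewrite comp_sumr; apply: eq_bigr => i _; rewrite compmA.
Qed.

End Rank.

(** * Decomposition of tame diagrams *)

Section Decomposition.
Variables (R : realType) (D : abelian_category) (S : D).
Variables (gS : line_generator S) (simS : simple_object S).
Hypothesis uniS : forall S' : D, simple_object S' -> isomorphic S S'.
Variable F : diagram R D.

Lemma dmor_irr (u v : R) (h h' : u <= v) : dmor F h = dmor F h'.
Proof. by congr (dmor F _); exact: bool_irrelevance. Qed.

Lemma persE (u v : R) (h : u <= v) : pers F u v = length (im (dmor F h)).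
Proof.
by rewrite /pers; case: {-}_ / idP => [h'|//]; rewrite (dmor_irr h h').
Qed.

(* A decomposition of F over L into interval modules: the i-th summand is
   spanned by e t i, and its interval is the set of t with e t i != 0. *)
Definition interval_basis (L : set R) (I : finType)
    (e : forall t, I -> mor S (F t)) : Prop :=
  (forall t, L t -> is_basis (e t)) /\
  forall s t (h : s <= t), L s -> L t ->
    forall i, e s i != 0 -> dmor F h \cm e s i = e t i.

Lemma interval_basis_dual (I : finType) (e : forall t, I -> mor S (F t)) :
  interval_basis setT e ->
  exists p : forall t, I -> mor (F t) S, forall t, is_dual (e t) (p t).
Proof.
move=> [eb _]; pose dual t := cid (basis_dual gS (eb t Logic.I)).
by exists (fun t => projT1 (dual t)) => t; exact: projT2 (dual t).
Qed.

Definition decomposable (L : set R) : Prop :=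
  exists (I : finType) (e : forall t, I -> mor S (F t)), interval_basis L e.

Lemma pers_bijective (a b : R) (h : a <= b) : pers F a a = pers F a b ->
  pers F a b = pers F b b -> point_bijective S (dmor F h).
Proof.
rewrite (persE h) (persE (lexx a)) (persE (lexx b)) !dmor_id.
rewrite !(length_im_id gS simS uniS) => ea eb.
exact: (length_im_bijective gS simS uniS).
Qed.

Lemma regular_bijective (x : R) : regular_value F x -> exists2 r : R, 0 < r &
  forall a b (h : a <= b), `|x - a| < r -> `|x - b| < r ->
    point_bijective S (dmor F h).
Proof.
move=> [I [/nbhs_ballP[r /= r0 rI] _ constI]]; exists r => // a b h xa xb.
by have [e1 e2] := constI a b (rI a xa) (rI b xb) h; exact: pers_bijective.
Qed.

(** Continuous induction: regularity at the supremum [m] of the points reached from [s] by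
    bijections gives bijections across [m], so [m] is reached and cannot lie before [t]. *)
Lemma regular_segment_bijective (s t : R) (h : s <= t) :
  (forall x, s <= x <= t -> regular_value F x) ->
  point_bijective S (dmor F h).
Proof.
move=> reg.
pose A := [set x | s <= x <= t /\ forall k : s <= x, point_bijective S (dmor F k)].
have As : A s.
  by split=> [|k]; [rewrite lexx | rewrite dmor_id; exact: point_bijective_id].
have tA : ubound A t by move=> x [/andP[]].
have supA : has_sup A by split; [exists s | exists t].
pose m := sup A.
have sm : s <= m by exact: sup_ubound supA.2 _ As.
have mt : m <= t by apply: sup_le_ub => //; exists s.
have [|r r0 rP] := @regular_bijective m; first by apply: reg; rewrite sm mt.
have [x [/andP[sx xt] xA] mx] := sup_adherent r0 supA.
have xm : x <= m by apply: sup_ubound supA.2 _ _; split=> //; rewrite sx xt.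
have far y : m <= y -> y - m < r -> y <= t -> A y.
  move=> my ymr yt; split=> [|k]; first by rewrite (le_trans sm my).
  rewrite (dmor_comp F sx (le_trans xm my)); apply: point_bijective_comp => //.
  apply: rP; first by rewrite ger0_norm ?subr_ge0 // ltrBlDr -ltrBlDl.
  by rewrite distrC ger0_norm // subr_ge0.
have mE : m = t.
  apply/eqP; rewrite eq_le mt leNgt; apply/negP => lt_mt.
  pose y := Num.min t (m + r / 2).
  have my : m < y by rewrite lt_min lt_mt ltrDl divr_gt0.
  have : A y.
    apply: far; [exact: ltW| |by rewrite ge_min lexx].
    by rewrite ltrBlDl gt_min ltrD2l [r / 2 < r]gtr_pMr // invf_lt1 ?ltr1n ?orbT.
  by move=> /(sup_ubound supA.2); rewrite leNgt my.
have [] // := far m; first by rewrite subrr.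
by rewrite mE.
Qed.

Lemma interval_basis_sub (L L' : set R) (I : finType)
    (e : forall t, I -> mor S (F t)) :
  L `<=` L' -> interval_basis L' e -> interval_basis L e.
Proof.
move=> LL' [eb etr]; split=> [t /LL'|s t h /LL' Ls /LL' Lt]; [exact: eb | exact: etr].
Qed.

(** One point [s] represents the whole new block. Elimination with target [F s] makes the surviving
    bars independent there; the vectors completing them to a basis are bars born in the block, and
    bijections carry this basis from [s] to the rest of it. *)
Lemma extend_decomposition (L L' : set R) : L `<=` L' ->
  (forall x y, L x -> L' y -> ~ L y -> x <= y) ->
  (forall x y (h : x <= y), L' x -> ~ L x -> L' y -> ~ L y ->
     point_bijective S (dmor F h)) ->
  decomposable L -> decomposable L'.
Proof.
move=> LL' Lle bij [I [e [eb etr]]].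
have [[s [L's Ls]]|/forallNP noL'] := pselect (exists s, L' s /\ ~ L s); last first.
  exists I, e; apply: (@interval_basis_sub L' L) => // t L't.
  by apply: contrapT => Lt; apply: (noL' t).
have le_s (t : {t | L t}) : sval t <= s by apply: Lle => //; exact: svalP.
have [|||e' [g [[e'b e'tr] e'g g_indep]]] :=
  @eliminate _ _ gS {t | L t} (fun s t => sval s <= sval t) (fun t => F (sval t))
    (fun s t h => dmor F h) (F s) (fun t => dmor F (le_s t)) _ _ I
    (fun t => e (sval t)).
- by move=> u v; apply/orP; exact: le_total.
- by move=> u v h; rewrite -dmor_comp.
- by split=> [t|u v h i]; [apply: eb | apply: etr]; exact: svalP.
have [J [f hb]] := indep_extend gS g_indep.
have wP t : exists w : I + J -> mor S (F t), L' t -> ~ L t ->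
    (forall (h : t <= s) k, dmor F h \cm w k = join_family g f k) /\
    (forall (h : s <= t) k, dmor F h \cm join_family g f k = w k).
  have [[L't Lt]|nt] := pselect (L' t /\ ~ L t); last first.
    by exists (fun=> 0) => L't Lt; case: nt.
  have [ts|st] := orP (le_total t s).
    have [_ surj] := bij _ _ ts L't Lt L's Ls.
    have [w wE] := choice (fun k => surj (join_family g f k)).
    exists w => _ _; split=> h k; first by rewrite (dmor_irr h ts).
    by rewrite -wE compmA -(dmor_comp _ _ _ (lexx t)) dmor_id comp1m.
  exists (fun k => dmor F st \cm join_family g f k) => _ _.
  split=> h k; last by rewrite (dmor_irr h st).
  by rewrite compmA -(dmor_comp _ _ _ (lexx s)) dmor_id comp1m.
pose w t := projT1 (cid (wP t)).
pose e2 t : I + J -> mor S (F t) := match pselect (L t) with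
  | left h => join_family (e' (exist _ t h)) (fun=> 0) | right _ => w t end.
exists (I + J)%type, e2; split=> [t L't|u v uv L'u L'v k]; rewrite /e2.
  case: pselect => [h|Lt].
    have [e'_indep e'_spans] := e'b (exist _ t h); split=> [c|x].
      rewrite sum_join [X in _ + X]big1 ?addr0 => [|j _]; last exact: comp0m.
      by move=> /e'_indep ec [i|j] /=; [exact: (ec i) | exact: comp0m].
    have [c ->] := e'_spans x; exists (fun k => if k is inl i then c i else 0).
    by rewrite sum_join [X in _ + X]big1 ?addr0 // => j _; rewrite comp0m.
  have := projT2 (cid (wP t)) L't Lt; rewrite -/(w t) => -[wl wr].
  have [ts|st] := orP (le_total t s).
    apply/(point_bijective_basis (w t) (bij _ _ ts L't Lt L's Ls)).
    by under eq_fun do rewrite wl.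
  have -> : w t = fun k => dmor F st \cm join_family g f k.
    by apply/funext => k; rewrite wr.
  exact/(point_bijective_basis _ (bij _ _ st L's Ls L't Lt)).
case: (pselect (L u)) => Lu; case: (pselect (L v)) => Lv.
- case: k => [i|j] /=; last by rewrite eqxx.
  exact: (e'tr (exist _ u Lu) (exist _ v Lv)).
- case: k => [i|j] /=; last by rewrite eqxx.
  have := projT2 (cid (wP v)) L'v Lv; rewrite -/(w v) => -[wl wr] eui.
  have gi : dmor F (le_s (exist _ u Lu)) \cm e' (exist _ u Lu) i = g i.
    exact: e'g.
  have [vs|sv] := orP (le_total v s).
    apply/eqP; rewrite -subr_eq0; apply/eqP.
    apply: (bij _ _ vs L'v Lv L's Ls).1.
    rewrite compBr wl compmA -(dmor_comp _ _ _ (le_s (exist _ u Lu))) gi.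
    by rewrite subrr.
  by rewrite -(wr sv) /= -gi compmA -dmor_comp.
- have /le_anti uE : u <= v <= u by rewrite uv (Lle v u).
  by case: Lu; rewrite uE.
- have := projT2 (cid (wP u)) L'u Lu; rewrite -/(w u) => -[ul ur].
  have := projT2 (cid (wP v)) L'v Lv; rewrite -/(w v) => -[vl vr] _.
  have [vs|sv] := orP (le_total v s).
    apply/eqP; rewrite -subr_eq0; apply/eqP.
    apply: (bij _ _ vs L'v Lv L's Ls).1.
    by rewrite compBr vl compmA -(dmor_comp _ _ _ (le_trans uv vs)) ul subrr.
  have [us|su] := orP (le_total u s).
    by rewrite -(vr sv) -(ul us) compmA -dmor_comp.
  by rewrite -(vr sv) -(ur su) compmA -dmor_comp.
Qed.

Lemma decomposable0 : decomposable set0.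
Proof. by exists void, (fun t => of_void (mor S (F t))). Qed.

(** A critical value [c] costs two extensions: by the regular gap before [c], then by the point [c],
    where the only structure map is the identity. After the last one, the rest is one regular
    block. *)
Lemma decomposable_finite (cs : seq R) : sorted <=%R cs ->
  forall L : set R, (forall x y, x <= y -> L y -> L x) ->
  (forall x, ~ L x -> ~ regular_value F x -> x \in cs) ->
  decomposable L -> decomposable setT.
Proof.
have sep (L L' : set R) : (forall x y, x <= y -> L y -> L x) ->
    forall x y, L x -> L' y -> ~ L y -> x <= y.
  move=> Ldown x y Lx _ Ly; rewrite leNgt.
  by apply: contra_notN Ly => /ltW /Ldown; exact.
have bij (L : set R) x y (h : x <= y) : (forall x y, x <= y -> L y -> L x) ->
    (forall z, x <= z <= y -> ~ L z -> regular_value F z) -> ~ L x ->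
    point_bijective S (dmor F h).
  move=> Ldown reg Lx; apply: regular_segment_bijective => z xzy.
  by apply: reg => // Lz; apply: Lx; apply: Ldown Lz; case/andP: xzy.
elim: cs => [|c cs IHcs] cs_sorted L Ldown Lcrit Ldec.
  apply: (extend_decomposition (L := L)) => //; first exact: sep.
  move=> x y h _ Lx _ _; apply: (bij L) => // z _ Lz.
  by apply: contrapT => /Lcrit-/(_ Lz).
have c_min x : x \in cs -> c <= x.
  by move: cs_sorted; rewrite /= (path_sortedE le_trans) => /andP[/allP H _] /H.
pose L1 := L `|` [set x | x < c].
have L1down x y : x <= y -> L1 y -> L1 x.
  by move=> xy [Ly|yc]; [left; exact: Ldown xy Ly | right; exact: le_lt_trans xy yc].
have L1dec : decomposable L1.
  apply: (extend_decomposition (L := L)) => // [x Lx||]; [by left|exact: sep|].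
  move=> x y h _ Lx [//|/= yc] _; apply: (bij L) => // z /andP[_ zy] Lz.
  apply: contrapT => /Lcrit-/(_ Lz); rewrite inE => zcs.
  have : c <= z by case/orP: zcs => [/eqP ->|/c_min].
  by rewrite leNgt (le_lt_trans zy yc).
pose L2 := L `|` [set x | x <= c].
have L2down x y : x <= y -> L2 y -> L2 x.
  by move=> xy [Ly|yc]; [left; exact: Ldown xy Ly | right; exact: le_trans xy yc].
apply: (IHcs (path_sorted cs_sorted) L2) => // [x L2x crit|].
  have Lx : ~ L x by move=> Lx; apply: L2x; left.
  have := Lcrit x Lx crit; rewrite inE => /orP[/eqP xc|//].
  by case: L2x; right; rewrite /= xc.
apply: (extend_decomposition (L := L1)) => // [x [Lx|/ltW xc]||];
  [by left|by right|exact: sep|].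
have eqc x : L2 x -> ~ L1 x -> x = c.
  move=> [Lx|/= xc] L1x; first by case: L1x; left.
  by apply/eqP; rewrite eq_le xc leNgt; apply/negP => h; case: L1x; right.
move=> x y h L2x L1x L2y L1y; have xE := eqc x L2x L1x; have yE := eqc y L2y L1y.
by move: h; rewrite xE yE => h; rewrite dmor_id; exact: point_bijective_id.
Qed.

Lemma tame_decomposable : tame F -> decomposable setT.
Proof.
move=> /finite_seqP[cs csE].
apply: (decomposable_finite (sort_sorted le_total cs) (L := set0)) => //;
  last exact: decomposable0.
move=> x _ nreg.
by rewrite mem_sort; have : [set` cs] x by rewrite -csE.
Qed.

End Decomposition.

(** * Connected neighbourhoods in the extended reals *)

Section ExtendedReals.
Variable R : realType.
Implicit Types (x y z u v a b : \bar R) (A : set (\bar R)).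
Local Open Scope ereal_scope.

Lemma ereal_between x y : x < y -> exists2 r : R, x < r%:E & r%:E < y.
Proof.
case: x => [x||]; case: y => [y||] //.
- rewrite lte_fin => xy; exists ((x + y) / 2)%R; rewrite lte_fin.
    by rewrite midf_lt.
  by rewrite midf_lt.
- by exists (x + 1)%R; rewrite ?ltry // lte_fin ltrDl.
- by exists (y - 1)%R; rewrite ?ltNyr // lte_fin gtrDl oppr_lt0.
- by exists 0%R; rewrite ?ltry ?ltNyr.
Qed.

(** Omitting [z] would make the part of [A] below [z] open and closed in [A]. *)
Lemma connected_ereal_convex A x y z :
  connected A -> A x -> A y -> x <= z <= y -> A z.
Proof.
move=> cA Ax Ay /andP[xz zy]; apply: contrapT => Az.
have ltE t : A t -> (t <= z) = (t < z).
  by move=> At; rewrite le_eqVlt; case: eqP => // tz; case: Az; rewrite -tz.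
suff : A `&` [set t | t < z] = A.
  by move=> /seteqP[_ /(_ y Ay)[_ /=]]; rewrite ltNge zy.
apply: cA; first by exists x; split=> //=; rewrite -ltE.
  by exists [set t | t < z] => //; exact: open_ereal_lt_ereal.
exists [set t | t <= z]; first exact: closed_ereal_ge_ereal.
by apply/seteqP; split=> t [At /=]; rewrite ?ltE // -ltE.
Qed.

Lemma nbhs_lt_ereal_sup A u : nbhs u A -> u < +oo -> u < ereal_sup A.
Proof.
move=> uA uy.
suff [t At ut] : exists2 t, A t & u < t.
  by apply: lt_le_trans ut _; exact: ereal_sup_ubound.
case: u uA uy => [u uA _||[M [_ MA]] _] //.
- have [e /= e0 eA] : \forall y \near u, A y%:E by [].
  exists (u + e / 2)%:E; last by rewrite lte_fin ltrDl divr_gt0.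
  apply: eA; rewrite /= opprD addNKr normrN gtr0_norm ?divr_gt0 //.
  by rewrite gtr_pMr // invf_lt1 ?ltr1n.
- exists (M - 1)%:E; last by rewrite ltNyr.
  by apply: MA; rewrite lte_fin gtrDl oppr_lt0.
Qed.

Lemma ereal_inf_lt_nbhs A u : nbhs u A -> -oo < u -> ereal_inf A < u.
Proof.
move=> uA uy.
suff [t At ut] : exists2 t, A t & t < u.
  by apply: le_lt_trans ut; exact: ereal_inf_lbound.
case: u uA uy => [u uA _|[M [_ MA]] _|] //.
- have [e /= e0 eA] : \forall y \near u, A y%:E by [].
  exists (u - e / 2)%:E; last by rewrite lte_fin gtrDl oppr_lt0 divr_gt0.
  apply: eA; rewrite /= opprB addrC subrK gtr0_norm ?divr_gt0 //.
  by rewrite gtr_pMr // invf_lt1 ?ltr1n.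
- exists (M + 1)%:E; last by rewrite ltry.
  by apply: MA; rewrite lte_fin ltrDl.
Qed.

(** Connectedness is inherited from a real interval through the embedding and the closure; the
    closure supplies the infinite points. *)
Lemma connected_nbhs_between a b u :
  a < u \/ a = -oo -> u < b \/ b = +oo ->
  exists A, [/\ nbhs u A, connected A & forall x, A x -> a <= x <= b].
Proof.
move=> au ub; pose J := [set r : R | a < r%:E < b].
exists (closure (EFin @` J)); split.
- have lo : nbhs u [set x | a < x \/ a = -oo].
    case: au => [au|->]; last by apply: filterS filterT => ?; right.
    by apply: filterS (open_ereal_gt' au) => ?; left.
  have hi : nbhs u [set x | x < b \/ b = +oo].
    case: ub => [ub|->]; last by apply: filterS filterT => ?; right.
    by apply: filterS (open_ereal_lt' ub) => ?; left.
  apply: filterS (filterI lo hi) => x [/= ax xb] N xN.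
  case: x ax xb xN => [x||] ax xb xN.
  + exists x%:E; split; last exact: nbhs_singleton.
    exists x => //; apply/andP; split.
      by case: ax => [//|->]; rewrite ltNyr.
    by case: xb => [//|->]; rewrite ltry.
  + have by_ : b = +oo by case: xb => //; rewrite ltNge leey.
    have ay : a < +oo by case: ax => [//|->].
    have [M [_ MP]] := filterI xN (open_ereal_gt' ay).
    have [|NM aM] := MP (M + 1)%:E; first by rewrite lte_fin ltrDl.
    by exists (M + 1)%:E; split=> //; exists (M + 1)%R => //; rewrite /J /= aM by_ ltry.
  + have aN : a = -oo by case: ax => //; rewrite ltNge leNye.
    have bN : -oo < b by case: xb => [//|->].
    have [M [_ MP]] := filterI xN (open_ereal_lt' bN).
    have [|NM aM] := MP (M - 1)%:E; first by rewrite lte_fin gtrDl oppr_lt0.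
    by exists (M - 1)%:E; split=> //; exists (M - 1)%R => //; rewrite /J /= aM aN ltNyr.
- apply: connected_closure; apply: connected_continuous_connected.
    apply/connected_intervalP => r s /andP[ar rb] /andP[as_ sb] t /andP[rt ts].
    apply/andP; split; first by apply: lt_le_trans ar _; rewrite lee_fin.
    by apply: le_lt_trans sb; rewrite lee_fin.
  by apply: continuous_subspaceT => r B.
- suff : closure (EFin @` J) `<=` [set y | a <= y <= b] by [].
  have <- : closure [set y | a <= y <= b] = [set y | a <= y <= b].
    apply/esym/closure_id.
    rewrite (_ : [set y | _] = [set y | a <= y] `&` [set y | y <= b]).
      by apply: closedI; [exact: closed_ereal_le_ereal|exact: closed_ereal_ge_ereal].
    by apply/seteqP; split=> y /= => [/andP[]|[-> ->]].
  apply: closureS => _ [r /andP[ar rb] <-] /=; rewrite (ltW ar); exact: ltW.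
Qed.

(** The condition bears on the hull of [A], because box counts are evaluated at its infimum and
    supremum. *)
Lemma isolating_nbhs u (s : seq (\bar R)) : exists A,
  [/\ nbhs u A, connected A
    & forall x, x \in s -> ereal_inf A <= x <= ereal_sup A -> x = u].
Proof.
suff [a [b [au ub sab]]] : exists a b, [/\ a < u \/ a = -oo, u < b \/ b = +oo
    & forall x, x \in s -> a <= x <= b -> x = u].
  have [A [uA cA Aab]] := connected_nbhs_between au ub.
  exists A; split=> // x xs /andP[Ax xA]; apply: sab => //; apply/andP; split.
    by apply: le_trans Ax; apply: le_ereal_inf_tmp => y /Aab /andP[].
  by apply: le_trans xA _; apply: ge_ereal_sup => y /Aab /andP[].
elim: s => [|x s [a [b [au ub sab]]]].
  by exists -oo, +oo; split; [right|right|].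
have [xu|ux|->] := ltgtP x u; last first.
- exists a, b; split=> // y; rewrite inE => /orP[/eqP ->//|]; exact: sab.
- have [m um mx] := ereal_between ux.
  exists a, (mine b m%:E); split=> //.
    left; rewrite lt_min um andbT; case: ub => [//|->].
    exact: lt_le_trans um (leey _).
  move=> y; rewrite inE le_min => /orP[/eqP ->|ys] /and3P[ay yb ym].
    by move: (le_lt_trans ym mx); rewrite ltxx.
  by apply: sab => //; rewrite ay.
- have [m xm mu] := ereal_between xu.
  exists (maxe a m%:E), b; split=> //.
    left; rewrite gt_max mu andbT; case: au => [//|->].
    exact: le_lt_trans (leNye _) mu.
  move=> y; rewrite inE ge_max => /orP[/eqP ->|ys] /andP[/andP[ay my] yb].
    by move: (lt_le_trans xm my); rewrite ltxx.
  by apply: sab => //; rewrite ay.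
Qed.

End ExtendedReals.

(** * Multiplicities count bars *)

Section Barcode.
Variables (R : realType) (D : abelian_category) (S : D).
Variables (gS : line_generator S) (simS : simple_object S).
Hypothesis uniS : forall S' : D, simple_object S' -> isomorphic S S'.
Variables (F : diagram R D) (I : finType) (e : forall t : R, I -> mor S (F t)).
Hypothesis eF : interval_basis setT e.
Implicit Types (r s t : R) (i : I) (x y u v : \bar R).

Definition alive t i : bool := e t i != 0.

(** A bar that is never alive gets birth +oo and death -oo, so it contributes no point to the
    diagram. *)
Definition birth i : \bar R := ereal_inf [set t%:E | t in [set t | alive t i]].
Definition death i : \bar R := ereal_sup [set t%:E | t in [set t | alive t i]].

Lemma alive_convex s r t i : s <= r -> r <= t -> alive s i -> alive t i ->
  alive r i.
Proof.
move=> sr rt si ti; apply: contra_neq ti => ri.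
rewrite -(eF.2 s t (le_trans sr rt)) // (dmor_comp F sr rt) -compmA.
by rewrite (eF.2 s r) // ri compm0.
Qed.

Lemma birth_le t i : alive t i -> (birth i <= t%:E)%E.
Proof. by move=> ti; apply: ereal_inf_lbound; exists t. Qed.

Lemma le_death t i : alive t i -> (t%:E <= death i)%E.
Proof. by move=> ti; apply: ereal_sup_ubound; exists t. Qed.

Lemma alive_between t i : (birth i < t%:E)%E -> (t%:E < death i)%E -> alive t i.
Proof.
move=> /ereal_inf_lt[_ [r ri <-] rt] /ereal_sup_gt[_ [s si <-] ts].
by apply: (@alive_convex r t s) => //; apply: ltW.
Qed.

Lemma pers_alive s t : s <= t -> pers F s t = (\sum_i (alive s i && alive t i))%N.
Proof.
move=> st; rewrite (persE _ st).
rewrite (length_im gS simS uniS (eF.1 s Logic.I) (eF.1 t Logic.I)); last first.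
  by move=> i; apply: eF.2.
rewrite -sum1_card big_mkcond; apply: eq_bigr => i _; rewrite in_nonzeros.
case: (boolP (alive s i)) => [si|]; first by rewrite eF.2 //; case: alive.
by rewrite negbK => /eqP ->; rewrite compm0 eqxx.
Qed.

Definition ealive x i : bool := if x is t%:E then alive t i else false.

Lemma ealive_bounds x i : ealive x i ->
  [/\ (birth i <= x)%E, (x <= death i)%E & x \is a fin_num].
Proof. by case: x => //= t ti; rewrite birth_le ?le_death. Qed.

Lemma ealive_between x i : (birth i < x)%E -> (x < death i)%E -> ealive x i.
Proof.
case: x => [t||]; first exact: alive_between.
  by rewrite [(+oo < _)%E]ltNge leey.
by rewrite ltNge leNye.
Qed.

Lemma ealive_convex x y z i : (x <= y)%E -> (y <= z)%E ->
  ealive x i -> ealive z i -> ealive y i.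
Proof.
case: x => // x; case: z => // z; case: y => [y||].
- by rewrite !lee_fin => xy yz; exact: alive_convex.
- by move=> _; rewrite leNgt ltry.
- by rewrite leNgt ltNyr.
Qed.

Lemma epers_alive x y : (x <= y)%E ->
  epers F x y = \sum_i (ealive x i && ealive y i)%:Z.
Proof.
case: x => [x||]; case: y => [y||] /= xy;
  try by rewrite big1 // => i _; rewrite ?andbF.
by rewrite pers_alive // (big_morph Posz PoszD (erefl _)).
Qed.

(** By convexity the times at which a bar is alive, among the four in increasing order, are
    consecutive; in every such pattern the alternating sum tells whether they are exactly the two
    middle ones. *)
Lemma box_count_alive (Iu Iv : set (\bar R)) : Iu !=set0 -> Iv !=set0 ->
  (ereal_sup Iu <= ereal_inf Iv)%E ->
  box_count F Iu Iv = \sum_i [&& ealive (ereal_sup Iu) i,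
    ealive (ereal_inf Iv) i, ~~ ealive (ereal_inf Iu) i
    & ~~ ealive (ereal_sup Iv) i]%:Z.
Proof.
have inf_le_sup (A : set (\bar R)) : A !=set0 -> (ereal_inf A <= ereal_sup A)%E.
  move=> [x Ax]; apply: (@le_trans _ _ x); first exact: ereal_inf_lbound.
  exact: ereal_sup_ubound.
move=> /inf_le_sup le01 /inf_le_sup le23 le12.
have le13 := le_trans le12 le23; have le02 := le_trans le01 le12.
have le03 := le_trans le01 le13.
rewrite /box_count !epers_alive // -!sumrB -big_split; apply: eq_bigr => i _ /=.
have h1 := @ealive_convex _ _ _ i le01 le12.
have h2 := @ealive_convex _ _ _ i le12 le23.
have h3 := @ealive_convex _ _ _ i le01 le13.
have h4 := @ealive_convex _ _ _ i le02 le23.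
move: h1 h2 h3 h4.
case: (ealive (ereal_inf Iu) i); case: (ealive (ereal_sup Iu) i);
case: (ealive (ereal_inf Iv) i); case: (ealive (ereal_sup Iv) i) => //= h1 h2 h3 h4.
all: by [rewrite ?subrr ?subr0 ?addr0 ?subrK | have := h1 isT isT |
         have := h2 isT isT | have := h3 isT isT | have := h4 isT isT].
Qed.

(** Every box counts the bars with endpoints [u] and [v], which are alive at the inner and dead at
    the outer times. A box isolating [u] and [v] from all other endpoints counts nothing else. *)
Lemma multiplicity_alive u v : (u < v)%E ->
  multiplicity F u v = #|[pred i | (birth i == u) && (death i == v)]|%:Z.
Proof.
move=> uv; set N := #|_|; pose Q i := (birth i == u) && (death i == v).
have NE : N%:Z = \sum_i (Q i)%:Z.
  rewrite /N -sum1_card big_mkcond (big_morph Posz PoszD (erefl _)).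
  by apply: eq_bigr => i _; rewrite inE -/(Q i); case: (Q i).
have boxP Iu Iv : nbhs u Iu -> connected Iu -> nbhs v Iv -> connected Iv ->
    Iu `&` Iv = set0 -> (ereal_sup Iu <= ereal_inf Iv)%E.
  move=> uI cIu vI cIv dis; have Iuu := nbhs_singleton uI.
  have Ivv := nbhs_singleton vI.
  apply: ge_ereal_sup => x Ix; apply: le_ereal_inf_tmp => y Iy.
  rewrite leNgt; apply/negP => yx; suff [z] : Iu `&` Iv !=set0 by rewrite dis.
  have [uy|/ltW yu] := leP u y.
    exists y; split=> //; apply: (connected_ereal_convex cIu Iuu Ix).
    by rewrite uy ltW.
  exists u; split=> //; apply: (connected_ereal_convex cIv Iy Ivv).
  by rewrite yu ltW.
have uy : (u < +oo)%E by apply: lt_le_trans uv (leey _).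
have vy : (-oo < v)%E by apply: le_lt_trans (leNye _) uv.
(* Either the infimum lies strictly before the birth, or both are -oo, where nothing is alive. *)
have notinf A i : nbhs u A -> birth i = u -> ~~ ealive (ereal_inf A) i.
  move=> uA bi; apply/negP => /ealive_bounds[]; rewrite bi.
  have [uN|uN] := eqVneq u -oo%E; last first.
    by rewrite leNgt ereal_inf_lt_nbhs // ltNye.
  move=> _ _; rewrite (_ : ereal_inf A = -oo%E) //.
  by apply/eqP; rewrite -leeNy_eq -uN; apply: ereal_inf_lbound; exact: nbhs_singleton.
have notsup A i : nbhs v A -> death i = v -> ~~ ealive (ereal_sup A) i.
  move=> vA di; apply/negP => /ealive_bounds[_]; rewrite di.
  have [vP|vP] := eqVneq v +oo%E; last first.
    by rewrite leNgt nbhs_lt_ereal_sup // ltey.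
  move=> _; rewrite (_ : ereal_sup A = +oo%E) //.
  by apply/eqP; rewrite -leye_eq -vP; apply: ereal_sup_ubound; exact: nbhs_singleton.
have minN z : box_counts F u v z -> N%:Z <= z.
  move=> [Iu [Iv [[uI cIu] [vI cIv] dis ->]]].
  have le12 := boxP _ _ uI cIu vI cIv dis.
  rewrite box_count_alive //; last 2 first.
    by exists u; exact: nbhs_singleton.
    by exists v; exact: nbhs_singleton.
  rewrite NE; apply: ler_sum => i _; rewrite /Q.
  case: eqP => [bi|//]; case: eqP => [di|_]; last by case: [&& _, _, _ & _].
  have uI1 := nbhs_lt_ereal_sup uI uy; have vI2 := ereal_inf_lt_nbhs vI vy.
  rewrite notinf // notsup // ealive_between ?bi ?di //; last first.
    exact: le_lt_trans le12 vI2.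
  by rewrite ealive_between ?bi ?di //; exact: lt_le_trans le12.
have boxN : box_counts F u v N%:Z.
  (* Avoiding a point [w] between [u] and [v] keeps the two neighbourhoods on either side of it,
     hence disjoint. *)
  have [w uw wv] := ereal_between uv.
  have [Iu [uI cIu isoU]] := isolating_nbhs u (w%:E :: [seq birth i | i <- enum I]).
  have [Iv [vI cIv isoV]] := isolating_nbhs v (w%:E :: [seq death i | i <- enum I]).
  have Iuu := nbhs_singleton uI; have Ivv := nbhs_singleton vI.
  have sup_w : (ereal_sup Iu < w%:E)%E.
    rewrite ltNge; apply/negP => h; suff wE : w%:E = u by rewrite wE ltxx in uw.
    apply: isoU; rewrite ?mem_head // h andbT.
    by apply: le_trans (ltW uw); exact: ereal_inf_lbound.
  have w_inf : (w%:E < ereal_inf Iv)%E.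
    rewrite ltNge; apply/negP => h; suff wE : w%:E = v by rewrite wE ltxx in wv.
    apply: isoV; rewrite ?mem_head // h /=.
    by apply: le_trans (ltW wv) _; exact: ereal_sup_ubound.
  have dis : Iu `&` Iv = set0.
    apply/seteqP; split=> // x [Ix Iy].
    have : (x < x)%E; last by rewrite ltxx.
    apply: le_lt_trans (ereal_sup_ubound Ix) _; apply: lt_trans sup_w _.
    by apply: lt_le_trans w_inf _; exact: ereal_inf_lbound.
  exists Iu, Iv; split=> //.
  have le12 := boxP _ _ uI cIu vI cIv dis.
  rewrite box_count_alive //; last 2 first.
    by exists u.
    by exists v.
  rewrite NE; apply: eq_bigr => i _; congr (_%:Z); congr nat_of_bool.
  have uI1 := nbhs_lt_ereal_sup uI uy; have vI2 := ereal_inf_lt_nbhs vI vy.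
  apply/andP/and4P => [[/eqP bi /eqP di]|[i1 i2 i0 i3]].
    rewrite notinf // notsup //; split=> //; apply: ealive_between; rewrite ?bi ?di //.
    - exact: le_lt_trans le12 vI2.
    - exact: lt_le_trans uI1 le12.
  have [b1 d1 _] := ealive_bounds i1; have [b2 d2 _] := ealive_bounds i2.
  split; apply/eqP.
    apply: isoU; first by rewrite inE map_f ?orbT ?mem_enum.
    rewrite b1 andbT leNgt; apply: contra i0 => b0; apply: ealive_between => //.
    by apply: lt_le_trans d1; apply: le_lt_trans (ereal_inf_lbound Iuu) uI1.
  apply: isoV; first by rewrite inE map_f ?orbT ?mem_enum.
  rewrite d2 /= leNgt; apply: contra i3 => d3; apply: ealive_between => //.
  by apply: le_lt_trans b2 _; apply: lt_le_trans vI2 (ereal_sup_ubound Ivv).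
apply: xget_subset1; first by split.
move=> x y [bx xP] [b_y yP]; apply/eqP; rewrite eq_le xP // yP //.
Qed.

End Barcode.

(** * Hall's theorem and a relational Cantor-Bernstein theorem *)

Section Hall.
Variables I J : finType.
Implicit Types (r : I -> J -> bool) (A B P : {set I}).

Definition neighbours r A : {set J} := finset (fun j => [exists i in A, r i j]).

(** The induction of Halmos and Vaughan: a proper nonempty [A] with exactly [#|A|] neighbours is
    matched separately from the rest; without such an [A], one vertex may take any neighbour, since
    every other subset has one to spare. *)
Lemma Hall_marriage r P :
  (forall A, A \subset P -> (#|A| <= #|neighbours r A|)%N) ->
  exists f : I -> option J,
    (forall i, i \in P -> exists2 j, f i = Some j & r i j) /\
    (forall i i', i \in P -> i' \in P -> f i = f i' -> i = i').
Proof.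
have [n] := ubnP #|P|; elim: n => // n IHn in r P *; rewrite ltnS => Pn hall.
have [-> | [i0 Pi0]] := finset.set_0Vmem P.
  by exists (fun=> None); split=> i; rewrite ?finset.in_set0.
have nbP r' A j : reflect (exists2 i, i \in A & r' i j) (j \in neighbours r' A).
  rewrite /neighbours inE; apply: (iffP existsP) => -[i].
    by case/andP; exists i.
  by move=> Ai rij; exists i; rewrite Ai.
have [|] := boolP [exists A : {set I},
    [&& A \subset P, A != P, (0 < #|A|)%N & #|neighbours r A| == #|A|]].
  case/existsP=> A /and4P[AP neAP A0 /eqP nbA].
  have prAP : A \proper P by rewrite finset.properEneq neAP.
  have [|B BA|f [fr finj]] := IHn r A; first exact: leq_trans (proper_card prAP) Pn.
    by apply: hall; exact: fintype.subset_trans BA AP.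
  pose r' i j := r i j && (j \notin neighbours r A).
  have [||f' [fr' finj']] := IHn r' (P :\: A)%SET.
  - apply: leq_trans Pn; rewrite cardsD (finset.setIidPr AP) ltn_subrL A0.
    exact: leq_trans A0 (subset_leq_card AP).
  - move=> B; rewrite finset.subsetD => /andP[BP disBA].
    have := hall (A :|: B)%SET; rewrite finset.subUset AP BP => /(_ isT) le_nb.
    have le_U : (#|(neighbours r A :|: neighbours r' B)%SET| <=
        #|A| + #|neighbours r' B|)%N.
      by rewrite -nbA; exact: (leq_card_setU _ _).1.
    rewrite -(leq_add2l #|A|); apply: leq_trans le_U.
    have -> : (#|A| + #|B|)%N = #|(A :|: B)%SET|.
      by apply/esym/eqP; rewrite (leq_card_setU _ _).2 disjoint_sym.
    apply: leq_trans le_nb _.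
    apply: subset_leq_card; apply/fintype.subsetP => j /nbP[i].
    rewrite !inE => /orP[iA rij|iB rij]; first
      by apply/orP; left; apply/existsP; exists i; rewrite iA.
    case: (boolP (j \in neighbours r A)) => [|jA]; first by rewrite inE => ->.
    by apply/orP; right; apply/existsP; exists i; rewrite iB /r' rij.
  exists (fun i => if i \in A then f i else f' i); split=> [i Pi|i i' Pi Pi'].
    have [iA|iA] := boolP (i \in A); first exact: fr.
    have [|j fj /andP[rij _]] := fr' i; first by rewrite inE iA.
    by exists j.
  have cross k l : k \in A -> l \in P -> l \notin A -> f k = f' l -> k = l.
    move=> kA lP lA; have [j -> rkj] := fr k kA.
    have [|j' -> /andP[_ /nbP nj']] := fr' l; first by rewrite inE lA.
    by move=> [jj]; case: nj'; exists k => //; rewrite -jj.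
  have [iA|iA] := boolP (i \in A); have [i'A|i'A] := boolP (i' \in A).
  - exact: finj.
  - exact: cross.
  - by move=> /esym /cross ->.
  - by apply: finj'; rewrite inE ?iA ?i'A.
rewrite negb_exists => /forallP strict.
have [j0 nb0] : exists j0, r i0 j0.
  have := hall [set i0]%SET; rewrite finset.sub1set Pi0 cards1.
  move=> /(_ isT) /card_gt0P[j /nbP[i]].
  by rewrite finset.inE => /eqP -> ?; exists j.
pose r' i j := r i j && (j != j0).
have [||f [fr finj]] := IHn r' (P :\ i0)%SET.
- by apply: leq_trans Pn; rewrite [X in (_ < X)%N](cardsD1 i0) Pi0.
- move=> A AP; have [->|[i Ai]] := finset.set_0Vmem A; first by rewrite cards0.
  have /andP[Ai0 AP'] : (i0 \notin A) && (A \subset P).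
    by move: AP; rewrite finset.subsetD1 andbC.
  have := strict A; rewrite AP' /=.
  have -> /= : A != P by apply: contraNneq Ai0 => ->.
  have -> /= : (0 < #|A|)%N by apply/card_gt0P; exists i.
  move=> ne; have : (#|A| < #|neighbours r A|)%N.
    by rewrite ltn_neqAle eq_sym ne hall.
  move=> /leq_trans ltA; rewrite -ltnS; apply: ltA.
  apply: (@leq_trans #|(j0 |: neighbours r' A)%SET|); last first.
    by rewrite cardsU1 -add1n leq_add2r leq_b1.
  apply: subset_leq_card; apply/fintype.subsetP => j /nbP[k kA rkj].
  rewrite !inE; case: eqP => //= /eqP jj0.
  by apply/existsP; exists k; rewrite kA /r' rkj.
exists (fun i => if i == i0 then Some j0 else f i); split=> [i Pi|i i' Pi Pi'].
  have [->|ii0] := eqVneq i i0; first by exists j0.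
  have [|j fj /andP[rij _]] := fr i; first by rewrite !inE ii0.
  by exists j.
have cross k : k \in P -> k != i0 -> Some j0 <> f k.
  move=> kP ki0; have [|j -> /andP[_ jj0]] := fr k; first by rewrite !inE ki0.
  by move=> [j0j]; rewrite j0j eqxx in jj0.
have [->|ii0] := eqVneq i i0; have [->|ii0'] := eqVneq i' i0 => //.
- by move=> /(cross _ Pi').
- by move=> /esym/(cross _ Pi).
- by apply: finj; rewrite !inE ?ii0 ?ii0'.
Qed.

End Hall.

(* The bijection agrees with f or with the inverse of g everywhere, so any
   relation respected by both is respected by the bijection. *)
Lemma Cantor_Bernstein_rel (T U : Type) (X : set T) (Y : set U)
    (r : T -> U -> Prop) (f : T -> U) (g : U -> T) :
  (forall x, X x -> Y (f x) /\ r x (f x)) -> {in X &, injective f} ->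
  (forall y, Y y -> X (g y) /\ r (g y) y) -> {in Y &, injective g} ->
  exists h : T -> U, set_bij X Y h /\ forall x, X x -> r x (h x).
Proof.
move=> fP finj gP ginj.
have fI x x' : X x -> X x' -> f x = f x' -> x = x'.
  by move=> Xx Xx'; apply: finj; rewrite inE.
have gI y y' : Y y -> Y y' -> g y = g y' -> y = y'.
  by move=> Yy Yy'; apply: ginj; rewrite inE.
(* The chains under [g \o f] starting outside the image of [g]. On them [h] is [f]; every other
   point of [X] has a preimage under [g], which [h] takes. *)
pose C x := exists n z, [/\ X z, ~ (exists2 y, Y y & g y = z)
                          & x = iter n (g \o f) z].
have CX x : C x -> X x.
  move=> [n [z [Xz _ ->]]]; elim: n => // n IHn.
  exact: (gP _ (fP _ IHn).1).1.
have /choice[h hP] : forall x, exists u, X x ->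
    (C x -> u = f x) /\ (~ C x -> Y u /\ g u = x).
  move=> x; have [Xx|nX] := pselect (X x); last by exists (f x).
  have [Cx|nC] := pselect (C x); first by exists (f x).
  have [y Yy yx] : exists2 y, Y y & g y = x.
    by apply: contrapT => nog; apply: nC; exists 0%N, x.
  by exists y.
have hC x : C x -> h x = f x by move=> Cx; apply: (hP x (CX x Cx)).1.
have hN x : X x -> ~ C x -> Y (h x) /\ g (h x) = x by move=> Xx; apply: (hP x Xx).2.
have Cgf x : C x -> C (g (f x)) by move=> [n [z [? ? ->]]]; exists n.+1, z.
exists h; split; last first.
  move=> x Xx; have [Cx|nC] := pselect (C x); first by rewrite hC //; exact: (fP x Xx).2.
  by have [Yh {1}<-] := hN x Xx nC; exact: (gP _ Yh).2.
split.
- move=> x Xx; have [Cx|nC] := pselect (C x); first by rewrite hC //; exact: (fP x Xx).1.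
  by have [] := hN x Xx nC.
- have cross x x' : C x -> X x' -> ~ C x' -> h x = h x' -> x = x'.
    move=> Cx Xx' nC'; rewrite hC // => hx; have [_ gh] := hN x' Xx' nC'.
    by case: nC'; rewrite -gh -hx; exact: Cgf.
  move=> x x' /set_mem Xx /set_mem Xx'.
  have [Cx|nC] := pselect (C x); have [Cx'|nC'] := pselect (C x').
  + by rewrite !hC //; exact: fI.
  + exact: cross.
  + by move=> /esym /cross ->.
  + by move=> hx; have [_ <-] := hN x Xx nC; have [_ <-] := hN x' Xx' nC'; rewrite hx.
- move=> y Yy; have [Xgy _] := gP y Yy.
  have [Cgy|nC] := pselect (C (g y)).
    have [[|n] [z [Xz nog gyE]]] := Cgy; first by case: nog; exists y.
    have Cx : C (iter n (g \o f) z) by exists n, z.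
    exists (iter n (g \o f) z); first exact: CX.
    rewrite hC //; apply: gI => //; exact: (fP _ (CX _ Cx)).1.
  by exists (g y) => //; have [Yh ghy] := hN _ Xgy nC; exact: gI.
Qed.

(** * Matrix coefficients of a morphism *)

(* Infinite values are replaced by large real ones. *)
Lemma real_model (R : realType) (s : seq (\bar R)) (c : R) : 0 <= c ->
  exists tau : \bar R -> R, forall u v c', u \in s -> v \in s -> 0 <= c' <= c ->
    (u <= v + c'%:E)%E = (tau u <= tau v + c').
Proof.
move=> c0.
(* [M] is so large that no shift by [c' <= c] makes up the distance between a finite value and the
   models [M] and [- M] of the infinite ones. *)
have [M [cM MP]] : exists M : R, c < M /\
    forall x, x \in s -> `|fine x| + c < M.
  elim: s => [|x s [M [cM MP]]]; first by exists (c + 1); rewrite ltrDl.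
  exists (M + `|fine x|); split=> [|y]; first by rewrite ltr_wpDr.
  rewrite inE => /orP[/eqP ->|/MP h]; first by rewrite addrC ltrD2r.
  by rewrite ltr_wpDr.
exists (fun x => match x with r%:E => r | +oo%E => M | -oo%E => - M end).
move=> u v c' us vs /andP[c'0 c'c].
have {us} := MP _ us; have {vs} := MP _ vs.
case: u => [u||]; case: v => [v||] /=; rewrite ?normr0 => hv hu.
all: rewrite ?addNye ?addye ?leeNy_eq ?leye_eq ?leey ?leNye //; apply/esym.
- by have := ler_norm u; lra.
- by apply/negbTE; rewrite -ltNge; have := ler_norm (- u); rewrite normrN; lra.
- by apply/negbTE; rewrite -ltNge; have := ler_norm v; lra.
- by rewrite eqxx; lra.
- by apply/negbTE; rewrite -ltNge; lra.
- by have := ler_norm (- v); rewrite normrN; lra.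
- by lra.
- by rewrite eqxx; lra.
Qed.

Lemma ereal_between_seq (R : realType) (x : \bar R) (s : seq (\bar R)) :
  (x < +oo)%E -> (forall y, y \in s -> (x < y)%E) ->
  exists2 t : R, (x < t%:E)%E & forall y, y \in s -> (t%:E < y)%E.
Proof.
move=> xy; elim: s => [_|y s IHs ys].
  by have [t xt _] := ereal_between xy; exists t.
have [|t xt ts] := IHs; first by move=> z zs; apply: ys; rewrite inE zs orbT.
have [r xr ry] := ereal_between (ys y (mem_head _ _)).
exists (Num.min t r); first by rewrite EFin_min lt_min xt xr.
move=> z; rewrite EFin_min gt_min inE => /orP[/eqP ->|/ts ->//].
by rewrite ry orbT.
Qed.

Section Coefficients.
Variables (R : realType) (D : abelian_category) (S : D).
Variable gS : line_generator S.
Variables (F G : diagram R D) (I J : finType).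
Variables (e : forall t : R, I -> mor S (F t))
  (h : forall t : R, J -> mor S (G t)).
Variables (p : forall t : R, I -> mor (F t) S) (q : forall t : R, J -> mor (G t) S).
Hypotheses (eF : interval_basis setT e) (hG : interval_basis setT h).
Hypotheses (ep : forall t, is_dual (e t) (p t)).
Hypotheses (hq : forall t, is_dual (h t) (q t)).

Lemma dual_dmor s t (k : s <= t) j :
  q t j \cm dmor G k = if h t j != 0 then q s j else 0.
Proof.
have [qh q0 _] := hq t; have [qh' q0' _] := hq s.
apply: (basis_eqm gS (hG.1 s Logic.I).2) => l.
have [->|sl] := eqVneq (h s l) 0; first by rewrite !compm0.
rewrite -compmA (hG.2 s t) // qh.
case: (h t j != 0); last by rewrite andbF comp0m.
by rewrite qh'; case: eqP => // ->; rewrite sl.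
Qed.

Variables (eps : R) (phi : forall t : R, mor (F t) (G (t + eps))).
Hypothesis phiN : forall s t (k : s <= t) (k' : s + eps <= t + eps),
  phi t \cm dmor F k = dmor G k' \cm phi s.

Definition coef t j i : mor S S := q (t + eps) j \cm phi t \cm e t i.

Lemma coef_alive t j i : coef t j i != 0 -> alive e t i /\ alive h (t + eps) j.
Proof.
move=> X0; split; apply: contra_neq X0 => t0; rewrite /coef.
  by rewrite t0 compm0.
by have [_ q0 _] := hq (t + eps); rewrite q0 // !comp0m.
Qed.

Lemma coef_dmor s t j i : s <= t -> alive e s i ->
  coef t j i = if alive h (t + eps) j then coef s j i else 0.
Proof.
move=> st si; have st' : s + eps <= t + eps by rewrite lerD2r.
rewrite /coef -(eF.2 s t st) // compmA -(compmA _ (phi t)) (phiN _ st').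
rewrite !compmA dual_dmor /alive; case: ifP => //; by rewrite !comp0m.
Qed.

Lemma coef_const s t j i : alive e s i -> alive h (s + eps) j ->
  alive e t i -> alive h (t + eps) j -> coef s j i = coef t j i.
Proof.
wlog st : s t / s <= t.
  move=> H; have [st|ts] := orP (le_total s t); first exact: H.
  by move=> *; apply/esym/H.
by move=> si _ _ tj; rewrite (coef_dmor _ st) // tj.
Qed.

(** A nonzero coefficient persists at all earlier times at which [i] is alive, which forces [j] to
    be alive [eps] after each of them. *)
Lemma coef_birth t j i : coef t j i != 0 ->
  (birth h j <= birth e i + eps%:E)%E.
Proof.
move=> X0; have [ti tj] := coef_alive X0.
rewrite -leeBlDr //; apply: le_ereal_inf_tmp => _ [s si <-].
rewrite leeBlDr // -EFinD; have [st|ts] := orP (le_total s t).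
  apply: birth_le; move: X0; rewrite (coef_dmor _ st) //.
  by case: ifP => [_ /coef_alive[]//|_]; rewrite eqxx.
by apply: le_trans (birth_le tj) _; rewrite lee_fin lerD2r.
Qed.

(** As long as [j] stays alive the coefficient stays nonzero and keeps [i] alive [eps] earlier. *)
Lemma coef_death t j i : coef t j i != 0 ->
  (death h j <= death e i + eps%:E)%E.
Proof.
move=> X0; have [ti tj] := coef_alive X0.
apply: ge_ereal_sup => _ [s sj <-]; rewrite -leeBlDr // -EFinB.
have [ts|st] := orP (le_total t (s - eps)); last first.
  by apply: le_trans (le_death ti); rewrite lee_fin.
apply: le_death; have := coef_dmor j ts ti; rewrite subrK (sj : alive h s j) => XE.
by apply: (@proj1 _ (alive h (s - eps + eps) j)); apply: coef_alive; rewrite XE.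
Qed.

(* A morphism between two interval modules is given by a scalar. *)
Lemma exists_coef : exists Phi : J -> I -> mor S S,
  (forall t j i, alive e t i -> alive h (t + eps) j -> coef t j i = Phi j i) /\
  (forall j i, Phi j i != 0 -> exists t, coef t j i != 0).
Proof.
suff /choice[Phi PhiP] : forall ji : J * I, exists x : mor S S,
    (forall t, alive e t ji.2 -> alive h (t + eps) ji.1 -> coef t ji.1 ji.2 = x) /\
    (x != 0 -> exists t, coef t ji.1 ji.2 != 0).
  exists (fun j i => Phi (j, i)).
  by split=> [t j i|j i]; [apply: (PhiP (j, i)).1|apply: (PhiP (j, i)).2].
move=> [j i] /=; have [[s X0]|/forallNP noX] := pselect (exists t, coef t j i != 0).
  exists (coef s j i); split; last by exists s.
  by have [si sj] := coef_alive X0 => t ti tj; apply: coef_const.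
exists 0; split; last by rewrite eqxx.
by move=> t _ _; apply/eqP; apply: contraT => /noX.
Qed.

End Coefficients.

(** * Stability *)

Section Stability.
Variables (R : realType) (D : abelian_category) (S : D).
Variable gS : line_generator S.
Variables (F G : diagram R D) (I J : finType).
Variables (e : forall t : R, I -> mor S (F t))
  (h : forall t : R, J -> mor S (G t)).
Hypotheses (eF : interval_basis setT e) (hG : interval_basis setT h).
Variables (eps : R) (eps_ge0 : 0 <= eps).

(** In this additive form an infinite value is close to itself and to nothing else. *)
Definition eps_close (x y : \bar R) : bool :=
  ((x <= y + eps%:E) && (y <= x + eps%:E))%E.

Definition close_bars i j : bool :=
  eps_close (birth e i) (birth h j) && eps_close (death e i) (death h j).

Definition long i : bool := (birth e i + (eps + eps)%:E < death e i)%E.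

Variables (phi : forall t : R, mor (F t) (G (t + eps))).
Variables (psi : forall t : R, mor (G t) (F (t + eps))).
Hypothesis phiN : forall s t (k : s <= t) (k' : s + eps <= t + eps),
  phi t \cm dmor F k = dmor G k' \cm phi s.
Hypothesis psiN : forall s t (k : s <= t) (k' : s + eps <= t + eps),
  psi t \cm dmor G k = dmor F k' \cm psi s.
Hypothesis psi_phi : forall t (k : t <= t + eps + eps),
  psi (t + eps) \cm phi t = dmor F k.

(* In a composite of nonzero components from bar (b, d) through bar (x, y) to
   bar (b', d') with b + d <= b' + d', the middle bar is close to one of the
   others. *)
Lemma close_to_an_end (b d x y b' d' : R) :
  x <= b + eps -> y <= d + eps -> b' <= x + eps -> d' <= y + eps ->
  b + d <= b' + d' ->
  (b <= x + eps) && (d <= y + eps) || (x <= b' + eps) && (y <= d' + eps).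
Proof.
move=> h1 h2 h3 h4 h5.
case: (leP b (x + eps)) => c1; case: (leP d (y + eps)) => c2 //=;
case: (leP x (b' + eps)) => c3; case: (leP y (d' + eps)) => c4 //=; exfalso; lra.
Qed.

(** With too few neighbours, some nonzero [c] supported on [A] would be killed by all rows of [Phi]
    indexed by neighbours. At the index [i] of its support with the largest [alpha], the
    unitriangular product then yields [c i = 0]. *)
Lemma Hall_condition (A : {set I}) : (forall i, i \in A -> long i) ->
  (#|A| <= #|neighbours close_bars A|)%N.
Proof.
move=> longA; rewrite leqNgt; apply/negP => lt_nA.
have [p ep] := interval_basis_dual gS eF.
have [q hq] := interval_basis_dual gS hG.
pose ends := [seq birth e i | i <- enum I] ++ [seq death e i | i <- enum I] ++
  [seq birth h j | j <- enum J] ++ [seq death h j | j <- enum J].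
have [tau tauP] := @real_model R ends (eps + eps) (addr_ge0 eps_ge0 eps_ge0).
have be i : birth e i \in ends by rewrite mem_cat map_f ?mem_enum.
have de i : death e i \in ends by rewrite !mem_cat map_f ?mem_enum ?orbT.
have bh j : birth h j \in ends.
  by rewrite !mem_cat [X in _ || (_ || (X || _))]map_f ?mem_enum ?orbT.
have dh j : death h j \in ends.
  by rewrite !mem_cat [X in _ || (_ || (_ || X))]map_f ?mem_enum ?orbT.
have eps1 : 0 <= eps <= eps + eps by rewrite eps_ge0 lerDr.
have eps2 : 0 <= eps + eps <= eps + eps by rewrite addr_ge0 ?lexx.
pose alpha i := tau (birth e i) + tau (death e i).
have longE i : i \in A -> tau (birth e i) + (eps + eps) < tau (death e i).
  by move=> /longA; rewrite /long !ltNge tauP.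
have overlap i i' : i \in A -> i' \in A -> alpha i <= alpha i' ->
    tau (birth e i) + (eps + eps) < tau (death e i').
  by move=> /longE li /longE li'; rewrite /alpha; lra.
(* t_ i is so close to the birth of i that every relevant bar is alive at
   t_ i + 2 eps. *)
have [t_ tP] : exists t_ : I -> R, forall i, i \in A ->
    (birth e i < (t_ i)%:E)%E /\
    forall i', (birth e i + (eps + eps)%:E < death e i')%E ->
      ((t_ i + eps + eps)%:E < death e i')%E.
  suff /choice[t_ tP] : forall i, exists t, i \in A ->
      (birth e i < t%:E)%E /\
      forall i', (birth e i + (eps + eps)%:E < death e i')%E ->
        ((t + eps + eps)%:E < death e i')%E by exists t_.
  move=> i; have [iA|_] := boolP (i \in A); last by exists 0.
  have [||t bt ts] := @ereal_between_seq R (birth e i)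
    [seq (death e i' - (eps + eps)%:E)%E | i' <- enum I &
      (birth e i + (eps + eps)%:E < death e i')%E].
  - rewrite ltey; apply: contraTneq (longA i iA) => bi.
    by rewrite /long bi addye // ltNge leey.
  - move=> y /mapP[i' + ->]; rewrite mem_filter => /andP[+ _].
    by rewrite lteBrDr.
  exists t => _; split=> // i' lt_i'; rewrite -addrA EFinD -lteBrDr //.
  by apply: ts; apply/mapP; exists i' => //; rewrite mem_filter lt_i' mem_enum.
have t_le i : t_ i <= t_ i + eps + eps by rewrite -addrA lerDl addr_ge0.
have t_alive i i' : i \in A -> i' \in A -> alpha i <= alpha i' ->
    (birth e i' <= birth e i + (eps + eps)%:E)%E ->
    alive e (t_ i + eps + eps) i'.
  move=> iA i'A le_a b'b; have [bt dt] := tP i iA.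
  apply: (alive_between eF); last by apply: dt; rewrite ltNge tauP // -ltNge overlap.
  by apply: le_lt_trans b'b _; rewrite -addrA [ltRHS]EFinD lteD2rE.
have t_alive0 i : i \in A -> alive e (t_ i) i.
  move=> iA; have [bt dt] := tP i iA; apply: (alive_between eF) => //.
  by apply: le_lt_trans (dt i (longA i iA)); rewrite lee_fin.
(* In a matrix product [Psi] must not depend on the column [i], hence the scalars of [exists_coef];
   [Phi j i] may be read off at the column's own time [t_ i]. *)
pose Phi j i := coef e q phi (t_ i) j i.
have [Psi [PsiE Psi0]] := exists_coef gS hG eF ep psiN.
have path i j i' : Phi j i != 0 -> Psi i' j != 0 ->
    [/\ (birth h j <= birth e i + eps%:E)%E, (death h j <= death e i + eps%:E)%E,
        (birth e i' <= birth h j + eps%:E)%E & (death e i' <= death h j + eps%:E)%E].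
  move=> X0 /Psi0[s Y0].
  split; [exact: coef_birth X0 | exact: coef_death X0 |
          exact: coef_birth Y0 | exact: coef_death Y0].
have PsiPhi i i' : i \in A -> i' \in A -> alpha i <= alpha i' ->
    \sum_(j in neighbours close_bars A) Psi i' j \cm Phi j i =
    if i' == i then idm S else 0.
  move=> iA i'A le_a.
  have [pe p0 _] := ep (t_ i + eps + eps); have [_ _ hq1] := hq (t_ i + eps).
  have ti : alive e (t_ i + eps + eps) i.
    by apply: t_alive => //; rewrite leeDl // lee_fin addr_ge0.
  have <- : p (t_ i + eps + eps) i' \cm psi (t_ i + eps) \cm phi (t_ i)
      \cm e (t_ i) i =
      if i' == i then idm S else 0.
    rewrite -(compmA _ (psi _)) (psi_phi (t_le i)) -compmA (eF.2 _ _ (t_le i)) //.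
      rewrite pe; case: eqP => //= ->; by rewrite (ti : e _ _ != 0).
    exact: t_alive0.
  rewrite -(comp1m (phi (t_ i))) -hq1 comp_suml comp_sumr comp_suml.
  rewrite big_mkcond; apply: eq_bigr => j _.
  rewrite -/(coef h p psi (t_ i + eps) i' j).
  have -> : p (t_ i + eps + eps) i' \cm psi (t_ i + eps) \cm
      (h (t_ i + eps) j \cm q (t_ i + eps) j \cm phi (t_ i)) \cm e (t_ i) i =
      coef h p psi (t_ i + eps) i' j \cm Phi j i by rewrite /coef /Phi !compmA.
  have [->|X0] := eqVneq (Phi j i) 0; first by rewrite !compm0; case: ifP.
  have [_ tj] := coef_alive hq X0.
  have YE : coef h p psi (t_ i + eps) i' j = Psi i' j.
    have [Psi0'|Psi0'] := eqVneq (Psi i' j) 0.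
      rewrite Psi0'; apply/eqP; apply: contraT => Y0.
      have [sj si'] := coef_alive ep Y0.
      by move: Y0; rewrite (PsiE _ _ _ sj si') Psi0' eqxx.
    apply: PsiE => //; apply: t_alive => //.
    have [p1 _ p3 _] := path _ _ _ X0 Psi0'.
    by apply: le_trans p3 _; rewrite EFinD addeA leeD2r.
  (* A nonzero term through [j] would, as [alpha i <= alpha i'], make [j] a neighbour of [i] or of
     [i']. *)
  rewrite YE; case: ifP => // /negbT nj.
  have [->|Psi0'] := eqVneq (Psi i' j) 0; first by rewrite comp0m.
  have [p1 p2 p3 p4] := path _ _ _ X0 Psi0'.
  case/negP: nj; rewrite inE; apply/existsP.
  move: (p1) (p2) (p3) (p4); rewrite !tauP // => r1 r2 r3 r4.
  have := close_to_an_end r1 r2 r3 r4 le_a.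
  case/orP => /andP[c1 c2]; [exists i|exists i'];
  rewrite ?iA ?i'A /close_bars /eps_close !tauP // ?r1 ?r2 ?r3 ?r4 ?c1 ?c2 //.
have [c [cA [i0 ci0] c0]] := lin_dep gS Phi lt_nA.
have [i ci imax] := @arg_maxP _ _ I i0 (fun i => c i != 0) alpha ci0.
have iA : i \in A by apply: contraNT ci => /cA ->.
have sum0 : \sum_(j in neighbours close_bars A) 
    Psi i j \cm (\sum_k Phi j k \cm c k) = 0.
  by rewrite big1 // => j jN; rewrite c0 // compm0.
case/eqP: ci; rewrite -[LHS](comp1m (c i)) -[RHS]sum0.
under [RHS]eq_bigr do rewrite comp_sumr.
rewrite exchange_big /= (bigD1 i) //= [X in _ = _ + X]big1 ?addr0.
  under [RHS]eq_bigr do rewrite compmA.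
  by rewrite -comp_suml PsiPhi // eqxx.
move=> k ki; have [->|ck] := eqVneq (c k) 0.
  by rewrite big1 // => j _; rewrite !compm0.
under eq_bigr do rewrite compmA.
have kA : k \in A by apply: contraNT ck => /cA ->.
rewrite -comp_suml PsiPhi //; last exact: imax.
by rewrite eq_sym (negPf ki) comp0m.
Qed.

Lemma exists_matching : exists f : I -> option J,
  (forall i, long i -> exists2 j, f i = Some j & close_bars i j) /\
  (forall i i', long i -> long i' -> f i = f i' -> i = i').
Proof.
have [A AP|f [fc finj]] := @Hall_marriage I J close_bars (finset long).
  by apply: Hall_condition => i /(fintype.subsetP AP); rewrite inE.
exists f; split=> [i li|i i' li li']; first by apply: fc; rewrite inE.
by apply: finj; rewrite inE.
Qed.

End Stability.

(** * From matchings to interleavings *)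

Section Converse.
Variables (R : realType) (D : abelian_category) (S : D).
Variable gS : line_generator S.
Variables eps eps' : R.
Hypothesis lt_eps : eps < eps'.

Section OneSided.
Variables (F G : diagram R D) (I J : finType).
Variables (e : forall t : R, I -> mor S (F t))
  (h : forall t : R, J -> mor S (G t)).
Hypotheses (eF : interval_basis setT e) (hG : interval_basis setT h).
Variable M : I -> J -> bool.
Hypothesis Mfun : forall i j j', M i j -> M i j' -> j = j'.
Hypothesis Mclose : forall i j, M i j -> close_bars e h eps i j.

(** Strictness comes from [eps < eps']: strictly past the birth it does not matter whether the bar
    contains its endpoint. *)
Lemma close_birth i j t : M i j -> alive e t i -> (birth h j < (t + eps')%:E)%E.
Proof.
move=> /Mclose/andP[/andP[_ ji] _] /birth_le ti; apply: le_lt_trans ji _.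
by apply: (@le_lt_trans _ _ (t%:E + eps%:E)%E); rewrite ?leeD2r // lte_fin ltrD2l.
Qed.

Lemma close_death i j t : M i j -> alive h (t + eps') j -> (t%:E < death e i)%E.
Proof.
move=> /Mclose/andP[_ /andP[_ ji]] /le_death tj.
have := le_trans tj ji; rewrite -leeBlDr // -EFinB; apply: lt_le_trans.
by rewrite lte_fin; have := lt_eps; lra.
Qed.

(** A map of bars is natural when the target is born and dies no later than the source; the shift by
    [eps'] brings each partner into this position. *)
Lemma exists_matching_map : exists phi : forall t, mor (F t) (G (t + eps')),
  [/\ forall s t (k : s <= t) (k' : s + eps' <= t + eps'),
        phi t \cm dmor F k = dmor G k' \cm phi s,
      forall t i j, M i j -> alive e t i -> phi t \cm e t i = h (t + eps') j
    & forall t i, (forall j, ~~ M i j) -> phi t \cm e t i = 0].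
Proof.
have [p ep] := interval_basis_dual gS eF.
pose phi t : mor (F t) (G (t + eps')) :=
  \sum_i (\sum_(j | M i j) h (t + eps') j) \cm p t i.
have phiE t i : phi t \cm e t i =
    if alive e t i then \sum_(j | M i j) h (t + eps') j else 0.
  have [pe _ _] := ep t.
  rewrite comp_suml (bigD1 i) //= -compmA pe eqxx.
  rewrite [X in _ + X = _]big1 ?addr0 => [|k ki].
    by rewrite /alive; case: (_ != 0) => /=; rewrite ?compm1 ?compm0.
  by rewrite -compmA pe (negPf ki) compm0.
have phi_match t i j : M i j -> alive e t i -> phi t \cm e t i = h (t + eps') j.
  move=> Mij ti; rewrite phiE ti (bigD1 j) //= big1 ?addr0 // => l /andP[Mil].
  by rewrite (Mfun Mij Mil) eqxx.
have phi0 t i : (forall j, ~~ M i j) -> phi t \cm e t i = 0.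
  move=> Mi; rewrite phiE; case: ifP => // _; rewrite big1 // => j.
  by rewrite (negPf (Mi j)).
exists phi; split=> // s t st st'; apply: (basis_eqm gS (eF.1 s Logic.I).2) => i.
have [->|si] := eqVneq (e s i) 0; first by rewrite !compm0.
rewrite -!compmA (eF.2 s t st) //.
have [/existsP[j Mij]|] := boolP [exists j, M i j]; last first.
  by rewrite negb_exists => /forallP Mi; rewrite !phi0 // compm0.
rewrite (phi_match _ _ _ Mij si).
(* For [s = t] naturality is trivial; for [s < t] the strict inequality keeps [t] off the birth of
   [i] and [s + eps'] off the death of [j]. *)
move: (st); rewrite le_eqVlt => /orP[/eqP ts|lt_st].
  move: st' {st}; rewrite -ts => st'.
  by rewrite dmor_id comp1m; exact: phi_match.
have [tj|tj] := eqVneq (h (t + eps') j) 0.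
  have -> : dmor G st' \cm h (s + eps') j = 0.
    have [->|sj] := eqVneq (h (s + eps') j) 0; first exact: compm0.
    by rewrite (hG.2 _ _ st').
  have [->|ti] := eqVneq (e t i) 0; first exact: compm0.
  by rewrite (phi_match _ _ _ Mij ti).
have ti : alive e t i.
  apply: (alive_between eF); last exact: close_death Mij tj.
  by apply: le_lt_trans (birth_le si) _; rewrite lte_fin.
have sj : alive h (s + eps') j.
  apply: (alive_between hG); first exact: close_birth Mij si.
  by apply: lt_le_trans (le_death tj); rewrite lte_fin ltrD2r.
by rewrite (phi_match _ _ _ Mij ti) (hG.2 _ _ st').
Qed.

End OneSided.

Lemma closeC (x y : \bar R) : eps_close eps x y = eps_close eps y x.
Proof. by rewrite /eps_close andbC. Qed.

Lemma close_barsC (F G : diagram R D) (I J : finType)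
    (e : forall t : R, I -> mor S (F t))
    (h : forall t : R, J -> mor S (G t)) i j :
  close_bars e h eps i j = close_bars h e eps j i.
Proof. by rewrite /close_bars !(closeC (_ e _)). Qed.

(** If the partner of a bar alive at [t] is dead at [t + eps'], closeness makes the bar dead at
    [t + eps' + eps']. So is an unmatched bar, which is not longer than [2 eps]. *)
Lemma matching_map_comp (F G : diagram R D) (I J : finType)
    (e : forall t : R, I -> mor S (F t))
    (h : forall t : R, J -> mor S (G t))
    (M : I -> J -> bool)
    (phi : forall t, mor (F t) (G (t + eps')))
    (psi : forall t, mor (G t) (F (t + eps'))) :
  0 <= eps -> interval_basis setT e -> interval_basis setT h ->
  (forall i j, M i j -> close_bars e h eps i j) ->
  (forall i, (forall j, ~~ M i j) -> ~~ long e eps i) ->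
  (forall t i j, M i j -> alive e t i -> phi t \cm e t i = h (t + eps') j) ->
  (forall t i, (forall j, ~~ M i j) -> phi t \cm e t i = 0) ->
  (forall t j i, M i j -> alive h t j -> psi t \cm h t j = e (t + eps') i) ->
  forall t (k : t <= t + eps' + eps'), psi (t + eps') \cm phi t = dmor F k.
Proof.
move=> eps0 eF hG Mclose Mshort phiM phi0 psiM t k.
apply: (basis_eqm gS (eF.1 t Logic.I).2) => i.
have [->|ti] := eqVneq (e t i) 0; first by rewrite !compm0.
rewrite (eF.2 _ _ k) // -compmA.
have [/existsP[j Mij]|] := boolP [exists j, M i j]; last first.
  rewrite negb_exists => /forallP Mi; rewrite phi0 // compm0.
  apply/esym/eqP; apply: contraT => t2i.
  case/negP: (Mshort i Mi); rewrite /long.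
  apply: lt_le_trans (le_death t2i); rewrite -addrA.
  apply: (@le_lt_trans _ _ (t%:E + (eps + eps)%:E)%E).
    by rewrite leeD2r // birth_le.
  by rewrite lte_fin; have := lt_eps; lra.
rewrite (phiM _ _ _ Mij ti).
have [tj|tj] := eqVneq (h (t + eps') j) 0; last exact: psiM.
rewrite tj compm0; apply/esym/eqP; apply: contraT => t2i.
have : alive h (t + eps') j; last by rewrite /alive tj eqxx.
apply: (alive_between hG); first exact: (close_birth Mclose Mij ti).
apply: (@close_death G F J I h e (fun j i => M i j)) t2i => // j' i' /Mclose.
by rewrite close_barsC.
Qed.

Lemma matching_interleaved (F G : diagram R D) (I J : finType)
    (e : forall t : R, I -> mor S (F t))
    (h : forall t : R, J -> mor S (G t))
    (M : I -> J -> bool) :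
  0 <= eps -> interval_basis setT e -> interval_basis setT h ->
  (forall i j j', M i j -> M i j' -> j = j') ->
  (forall i i' j, M i j -> M i' j -> i = i') ->
  (forall i j, M i j -> close_bars e h eps i j) ->
  (forall i, (forall j, ~~ M i j) -> ~~ long e eps i) ->
  (forall j, (forall i, ~~ M i j) -> ~~ long h eps j) ->
  interleaved eps' F G.
Proof.
move=> eps0 eF hG Mfun Minj Mclose shortF shortG.
have Mclose' j i : M i j -> close_bars h e eps j i.
  by move=> /Mclose; rewrite close_barsC.
have [phi [phiN phiM phi0]] := exists_matching_map eF hG Mfun Mclose.
have [psi [psiN psiM psi0]] := @exists_matching_map _ _ _ _ h e hG eF
  (fun j i => M i j) (fun j i i' => @Minj i i' j) Mclose'.
split; first exact: le_trans eps0 (ltW lt_eps).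
exists (@NatTrans R D F (Defs.shift eps' G) phi (fun a b k => phiN a b k _)).
exists (@NatTrans R D G (Defs.shift eps' F) psi (fun a b k => psiN a b k _)).
split=> t k /=.
  exact: (matching_map_comp eps0 eF hG Mclose).
by apply: (@matching_map_comp G F J I h e (fun j i => M i j)).
Qed.

End Converse.

(** * Persistence diagrams and bars *)

(** For negative [eps] equal infinite values are still [eps_close], whence the guard. *)
Lemma coord_dist_close (R : realType) (eps : R) (x y : \bar R) :
  (coord_dist x y <= eps%:E)%E = (0 <= eps) && eps_close eps x y.
Proof.
rewrite /eps_close; case: x => [x||]; case: y => [y||] /=;
  rewrite ?leeNy_eq ?leye_eq ?leey ?leNye ?andbF //= ?lee_fin ?andbT //.
rewrite ler_distl ?lee_fin.
case: (leP 0 eps) => eps0 /=; first by rewrite lerBlDr andbC.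
by apply/negbTE/negP => /andP[h1 h2]; have := le_trans h1 h2; rewrite lerD2l; lra.
Qed.

Lemma coord_dist_ge0 (R : realType) (x y : \bar R) : (0 <= coord_dist x y)%E.
Proof. by case: x => [x||]; case: y => [y||] //=; rewrite lee_fin. Qed.

Lemma point_dist_close (R : realType) (eps : R) (x y : \bar R * \bar R) :
  (point_dist x y <= eps%:E)%E =
  [&& 0 <= eps, eps_close eps x.1 y.1 & eps_close eps x.2 y.2].
Proof.
rewrite /point_dist ge_max !coord_dist_close.
by case: (0 <= eps).
Qed.

Section Points.
Variables (R : realType) (D : abelian_category) (S : D).
Variables (gS : line_generator S) (simS : simple_object S).
Hypothesis uniS : forall S' : D, simple_object S' -> isomorphic S S'.

Section OneDiagram.
Variables (F : diagram R D) (I : finType) (e : forall t : R, I -> mor S (F t)).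
Hypothesis eF : interval_basis setT e.

Definition bars (u v : \bar R) : seq I :=
  enum [pred i | (birth e i == u) && (death e i == v)].

(** The position among the bars with the same endpoints serves as the number of the copy. *)
Definition bar_point i : (\bar R * \bar R) * nat :=
  ((birth e i, death e i), index i (bars (birth e i) (death e i))).

Lemma mem_bars u v i : (i \in bars u v) = (birth e i == u) && (death e i == v).
Proof. by rewrite mem_enum. Qed.

Lemma bar_point_inj : injective bar_point.
Proof.
move=> i i' [bi di]; rewrite bi di => ii'.
have mi : i \in bars (birth e i') (death e i') by rewrite mem_bars bi di !eqxx.
have mi' : i' \in bars (birth e i') (death e i') by rewrite mem_bars !eqxx.
by rewrite -(nth_index i mi) ii' nth_index.
Qed.

Lemma persistence_diagramP x : persistence_diagram F x <->
  (exists2 i, (birth e i < death e i)%E & x = bar_point i) \/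
  (exists (r : R) k, x = ((r%:E, r%:E), k)).
Proof.
case: x => -[u v] k.
split=> [[[uv]|[r [-> ->]]]|[[i bd [-> -> ->]]|[r [l [-> -> _]]]]].
- rewrite (multiplicity_alive gS simS uniS eF uv) ltz_nat cardE -/(bars u v) => lt_k.
  left; have [i0 _] : exists i, i \in bars u v.
    by case: (bars u v) lt_k => // i l _; exists i; rewrite mem_head.
  have := mem_nth i0 lt_k; rewrite mem_bars => /andP[/eqP bu /eqP dv].
  exists (nth i0 (bars u v) k); first by rewrite bu dv.
  by rewrite /bar_point bu dv index_uniq // enum_uniq.
- by right; exists r, k.
- left; split=> //; rewrite (multiplicity_alive gS simS uniS eF bd) ltz_nat cardE.
  by rewrite index_mem mem_bars !eqxx.
- by right; exists r.
Qed.

(** Such a bar has finite endpoints, and its midpoint is within [eps] of both. *)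
Lemma short_bar eps i : 0 <= eps -> (birth e i < death e i)%E ->
  ~~ long e eps i -> exists r : R,
  eps_close eps (birth e i) r%:E /\ eps_close eps (death e i) r%:E.
Proof.
rewrite /long -leNgt /eps_close => eps0.
case: (birth e i) => [b||]; case: (death e i) => [d||] //=.
rewrite lte_fin lee_fin => bd db; exists ((b + d) / 2).
by rewrite !lee_fin; split; apply/andP; split; lra.
Qed.

Lemma diagonal_short eps i (r : R) : eps_close eps (birth e i) r%:E ->
  eps_close eps (death e i) r%:E -> ~~ long e eps i.
Proof.
rewrite /long -leNgt /eps_close.
case: (birth e i) => [b||]; case: (death e i) => [d||] //=.
- by rewrite !lee_fin => /andP[h1 h2] /andP[h3 h4]; lra.
- by rewrite leNye.
- by rewrite addNye leeNy_eq andbF.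
Qed.

End OneDiagram.

Lemma long_close_bars (F G : diagram R D) (I J : finType)
    (e : forall t : R, I -> mor S (F t))
    (h : forall t : R, J -> mor S (G t))
    eps i j : 0 <= eps -> long e eps i -> close_bars e h eps i j ->
  (birth h j < death h j)%E.
Proof.
rewrite /long /close_bars /eps_close => eps0.
case: (birth e i) => [b||]; case: (death e i) => [d||];
case: (birth h j) => [x||]; case: (death h j) => [y||];
  rewrite ?addNye ?addye ?leeNy_eq ?leye_eq ?leey ?leNye ?andbF ?ltry ?ltNyr //=.
by rewrite !lee_fin !lte_fin => h1 /andP[/andP[h2 h3] /andP[h4 h5]]; lra.
Qed.

(* Bars longer than 2 eps follow the matching, shorter ones collapse to the
   diagonal, where the points already present make room by raising the number
   of their copy. *)
Lemma diagram_injection (F G : diagram R D) (I J : finType)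
    (e : forall t : R, I -> mor S (F t))
    (h : forall t : R, J -> mor S (G t))
    (eps : R) (m : I -> option J) :
  interval_basis setT e -> interval_basis setT h -> 0 <= eps ->
  (forall i, long e eps i -> exists2 j, m i = Some j & close_bars e h eps i j) ->
  (forall i i', long e eps i -> long e eps i' -> m i = m i' -> i = i') ->
  exists f, (forall x, persistence_diagram F x ->
      persistence_diagram G (f x) /\ (point_dist x.1 (f x).1 <= eps%:E)%E) /\
    {in persistence_diagram F &, injective f}.
Proof.
move=> eF hG eps0 mclose minj.
(* At each diagonal point the first [N] copies are set free, one for each bar that may collapse
   there. *)
pose N := #|I|.
pose P x y := [\/ exists i j, [/\ x = bar_point e i, long e eps i, m i = Some j,
                                 close_bars e h eps i j & y = bar_point h j],
  exists i (r : R), [/\ x = bar_point e i, eps_close eps (birth e i) r%:E,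
      eps_close eps (death e i) r%:E & y = ((r%:E, r%:E), nat_of_ord (enum_rank i))] |
  exists (r : R) k, x = ((r%:E, r%:E), k) /\ y = ((r%:E, r%:E), (k + N)%N)].
have /choice[f fP] : forall x, exists y, persistence_diagram F x -> P x y.
  move=> x; have [Fx|nF] := pselect (persistence_diagram F x); last by exists x.
  case/(persistence_diagramP eF): Fx => [[i bd xE]|[r [k xE]]]; last first.
    by exists ((r%:E, r%:E), (k + N)%N) => _; apply: Or33; exists r, k.
  have [li|si] := boolP (long e eps i).
    have [j mj ij] := mclose i li.
    by exists (bar_point h j) => _; apply: Or31; exists i, j.
  have [r [br dr]] := short_bar eps0 bd si.
  by exists ((r%:E, r%:E), nat_of_ord (enum_rank i)) => _; apply: Or32; exists i, r.
have close_refl (r : R) : eps_close eps r%:E r%:E.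
  by rewrite /eps_close -EFinD !lee_fin lerDl eps0.
exists f; split=> [x /fP|x x' /set_mem/fP + /set_mem/fP + ff].
  case=> [[i [j [-> li _ ij ->]]]|[i [r [-> br dr ->]]]|[r [k [-> ->]]]].
  - split; last by rewrite point_dist_close eps0.
    apply/(persistence_diagramP hG); left; exists j => //.
    exact: long_close_bars ij.
  - split; last by rewrite point_dist_close eps0 /= br dr.
    by apply/(persistence_diagramP hG); right; exists r, (enum_rank i).
  - split; last by rewrite point_dist_close eps0 /= close_refl.
    by apply/(persistence_diagramP hG); right; exists r, (k + N)%N.
have offdiag i j (r : R) k : long e eps i -> close_bars e h eps i j ->
    bar_point h j = ((r%:E, r%:E), k) -> False.
  move=> li ij [br dr _]; have := long_close_bars eps0 li ij.
  by rewrite br dr ltxx.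
have ltN i : (enum_rank i < N)%N := ltn_ord (enum_rank i).
rewrite -ff => -[[i [j [-> li mi ij fx]]]|[i [r [-> br dr fx]]]|[r [k [-> fx]]]];
case=> [[i' [j' [-> li' mi' ij' fx']]]|[i' [r' [-> br' dr' fx']]]|[r' [k' [-> fx']]]];
have {fx'} := fx'; rewrite fx.
- by move/bar_point_inj => jj; congr bar_point; apply: minj; rewrite // mi mi' jj.
- by move/(offdiag _ _ _ _ li ij).
- by move/(offdiag _ _ _ _ li ij).
- by move/esym/(offdiag _ _ _ _ li' ij').
- by case=> _ _ /val_inj/enum_rank_inj ->.
- by case=> _ _ iN; have := ltN i; rewrite iN ltnNge leq_addl.
- by move/esym/(offdiag _ _ _ _ li' ij').
- by case=> _ _ iN; have := ltN i'; rewrite -iN ltnNge leq_addl.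
- by case=> -> _ /addIn ->.
Qed.

End Points.

(** * The isometry theorem *)

Section Isometry.
Variables (R : realType) (D : abelian_category) (S : D).
Variables (gS : line_generator S) (simS : simple_object S).
Hypothesis uniS : forall S' : D, simple_object S' -> isomorphic S S'.
Variables (F G : diagram R D) (I J : finType).
Variables (e : forall t : R, I -> mor S (F t))
  (h : forall t : R, J -> mor S (G t)).
Hypotheses (eF : interval_basis setT e) (hG : interval_basis setT h).

Lemma long_lt (K : diagram R D) (L : finType) (k : forall t : R, L -> mor S (K t))
    (eps : R) i : 0 <= eps -> long k eps i -> (birth k i < death k i)%E.
Proof.
by move=> eps0; apply: le_lt_trans; rewrite leeDl // lee_fin addr_ge0.
Qed.

Lemma interleaved_bottleneck eps : interleaved eps F G ->
  (bottleneck_distance F G <= eps%:E)%E.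
Proof.
move=> [eps0 [phi [psi [psiphi phipsi]]]].
have phiN s t (k : s <= t) (k' : s + eps <= t + eps) :
    phi t \cm dmor F k = dmor G k' \cm phi s.
  by rewrite (naturality phi) /=; congr (_ \cm _); exact: dmor_irr.
have psiN s t (k : s <= t) (k' : s + eps <= t + eps) :
    psi t \cm dmor G k = dmor F k' \cm psi s.
  by rewrite (naturality psi) /=; congr (_ \cm _); exact: dmor_irr.
have [m [mc minj]] := exists_matching gS eF hG eps0 phiN psiN psiphi.
have [m' [mc' minj']] := exists_matching gS hG eF eps0 psiN phiN phipsi.
have [f [fP finj]] := diagram_injection gS simS uniS eF hG eps0 mc minj.
have [g [gP ginj]] := diagram_injection gS simS uniS hG eF eps0 mc' minj'.
pose r (x y : (\bar R * \bar R) * nat) := (point_dist x.1 y.1 <= eps%:E)%E.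
have gP' y : persistence_diagram G y ->
    persistence_diagram F (g y) /\ r (g y) y.
  move=> /gP[Fgy]; rewrite /r !point_dist_close => /and3P[_ c1 c2].
  by split=> //; rewrite eps0 closeC c1 closeC c2.
have [b [bij br]] := @Cantor_Bernstein_rel _ _ _ _ r f g fP finj gP' ginj.
apply: ge_ereal_inf; exists (ereal_sup [set point_dist q.1 (b q).1
  | q in persistence_diagram F]); first by exists b.
by apply: ge_ereal_sup => _ [q Fq <-]; exact: br.
Qed.

(** A bar sent to a diagonal point lies within [eps] of it and so is not long; only pairs of bars
    enter the matching. *)
Lemma bottleneck_interleaved
    (b : (\bar R * \bar R) * nat -> (\bar R * \bar R) * nat)
    (eps eps' : R) :
  set_bij (persistence_diagram F) (persistence_diagram G) b ->
  (forall q, persistence_diagram F q -> (point_dist q.1 (b q).1 <= eps%:E)%E) ->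
  0 <= eps -> eps < eps' -> interleaved eps' F G.
Proof.
move=> [bfun binj bsurj] bd eps0 lt_eps.
have FP := persistence_diagramP gS simS uniS eF.
have GP := persistence_diagramP gS simS uniS hG.
have bclose q : persistence_diagram F q ->
    eps_close eps q.1.1 (b q).1.1 /\ eps_close eps q.1.2 (b q).1.2.
  by move=> /bd; rewrite point_dist_close => /and3P[].
(* The guards discard bars with at most one point: a one-point bar would be confused with a copy of
   a diagonal point. *)
pose M i j := [&& (birth e i < death e i)%E, (birth h j < death h j)%E
  & b (bar_point e i) == bar_point h j].
apply: (@matching_interleaved _ _ _ gS eps eps' lt_eps F G I J e h M) => //.
- move=> i j j' /and3P[_ _ /eqP ij] /and3P[_ _ /eqP ij'].
  by apply: (@bar_point_inj _ _ _ _ _ h); rewrite -ij -ij'.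
- move=> i i' j /and3P[bi _ /eqP ij] /and3P[bi' _ /eqP i'j].
  apply: (@bar_point_inj _ _ _ _ _ e); apply: binj; rewrite ?inE ?ij ?i'j //.
    by apply/FP; left; exists i.
  by apply/FP; left; exists i'.
- move=> i j /and3P[bi _ /eqP ij]; have [|c1 c2] := bclose (bar_point e i).
    by apply/FP; left; exists i.
  by move: c1 c2; rewrite ij /close_bars => -> ->.
- move=> i Mi; apply/negP => li; have bi := long_lt eps0 li.
  have Fi : persistence_diagram F (bar_point e i) by apply/FP; left; exists i.
  have [c1 c2] := bclose _ Fi.
  have /GP[[j bj ij]|[r [k ij]]] := bfun _ Fi.
    by have := Mi j; rewrite /M bi bj ij eqxx.
  rewrite ij in c1 c2.
  by have := diagonal_short (r := r) c1 c2; rewrite li.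
- move=> j Mj; apply/negP => lj; have bj := long_lt eps0 lj.
  have Gj : persistence_diagram G (bar_point h j) by apply/GP; left; exists j.
  have [q Fq qj] := bsurj _ Gj; have [c1 c2] := bclose _ Fq.
  move: (Fq) => /FP[[i bi qi]|[r [k qr]]].
    by have := Mj i; rewrite /M bi bj -qi qj eqxx.
  rewrite qj qr closeC /= in c1; rewrite qj qr closeC /= in c2.
  by have := diagonal_short (r := r) c1 c2; rewrite lj.
Qed.

Lemma interleaving_bottleneck :
  interleaving_distance F G = bottleneck_distance F G.
Proof.
apply/eqP; rewrite eq_le; apply/andP; split; last first.
  by apply: le_ereal_inf_tmp => _ [eps ieps <-]; exact: interleaved_bottleneck.
apply: le_ereal_inf_tmp => _ [b bij <-].
set s := ereal_sup _.
have sP q : persistence_diagram F q -> (point_dist q.1 (b q).1 <= s)%E.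
  by move=> Fq; apply: ereal_sup_ubound; exists q.
have s0 : (0 <= s)%E.
  (* The diagonal keeps the diagram nonempty, so the supremum is not -oo. *)
  have Fq : persistence_diagram F ((0%:E, 0%:E), 0%N) by right; exists 0.
  apply: le_trans (sP _ Fq); rewrite /point_dist le_max coord_dist_ge0 //.
case: s s0 sP => [eps||]; [|by move=> _ _; rewrite leey|by rewrite leeNy_eq].
rewrite lee_fin => eps0 sP; apply/lee_addgt0Pr => d d0.
apply: ereal_inf_lbound; exists (eps + d) => //.
by apply: (bottleneck_interleaved bij sP) => //; rewrite ltrDl.
Qed.

End Isometry.

Theorem theorem3 (R : realType) (D : abelian_category)
    (D_semisimple : semisimple D) (D_unique_simple : unique_simple D)
    (F G : diagram R D) (F_tame : tame F) (G_tame : tame G) :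
  interleaving_distance F G = bottleneck_distance F G.
Proof.
have [S simS uniS] := D_unique_simple.
have gS := simple_line_generator D_semisimple simS uniS.
have [I [e eF]] := tame_decomposable gS simS uniS F_tame.
have [J [h hG]] := tame_decomposable gS simS uniS G_tame.
exact: (interleaving_bottleneck gS simS uniS eF hG).
Qed.
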